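(* Let $Y$ be one of the spaces $M_1$, $M_1^u$, $M_1^s$, or $Y=M_p$ for some $p\in(1,\infty)$, equipped with its norm topology. Then the set $$\{(\boldsymbol f,x)\in Y\times K:\ \limsup_{n\to\infty} f_n(x)=+\infty \text{ and } \liminf_{n\to\infty} f_n(x)=-\infty\}$$ is a dense $G_\delta$ subset of $Y\times K$. In particular, there is a dense $G_\delta$ subset of $Y$ such that for every $\boldsymbol f$ in it one has $\limsup_{n} f_n(x)=+\infty$ and $\liminf_n f_n(x)=-\infty$ for all $x$ from a dense $G_\delta$ subset of $K$ (depending on $\boldsymbol f$).
   Context: Setting: $(\Omega,\Sigma,P)$ is a probability space and $(\Sigma_n)_{n\in\mathbb N}$ is a filtration of finite $\sigma$-algebras, i.e. an increasing sequence of finite $\sigma$-subalgebras of $\Sigma$. For each $n$, $\mathcal D_n$ is the finite partition of $\Omega$ (into nonempty sets) generating $\Sigma_n$; thus $\mathcal D_m$ refines $\mathcal D_n$ for $m\ge n$. Standing assumptions: (1) $P(D)>0$ for each $n\in\mathbb N$ and $D\in\mathcal D_n$; (2) for each $n\in\mathbb N$ and $D\in\mathcal D_n$ there is $m>n$ with $D\notin\mathcal D_m$. The space $K$: $K=\{(D_n)\in\prod_{n\in\mathbb N}\mathcal D_n : D_m\subset D_n \text{ for } m\ge n\}$, with the topology inherited from the product, each $\mathcal D_n$ being discrete (a metrizable compact space). Martingales: a martingale (adapted to $(\Sigma_n)$) is a sequence $\boldsymbol f=(f_n)$ with $f_n\in L^1(\Omega,\Sigma_n,P|_{\Sigma_n})$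 and $\int_E f_n\,dP=\int_E f_m\,dP$ whenever $n\le m$ and $E\in\Sigma_n$. Each $f_n$ is constant on each $D\in\mathcal D_n$; that value is denoted $f_n(D)$. For $x=(D_k)_{k}\in K$ we write $f_n(x)=f_n(D_n)$. Spaces: for $1\le p\le\infty$, $M_p$ is the Banach space of all martingales adapted to $(\Sigma_n)$ with $\|\boldsymbol f\|_p=\sup_n\|f_n\|_{L^p}<\infty$. $M_1^u$ is the subspace of $M_1$ of uniformly integrable martingales. $M_1^s$ is the subspace of $M_1$ of martingales with $f_n\to0$ $P$-almost surely on $\Omega$. The subspaces carry the norm $\|\cdot\|_1$. *)

(* Defs.v *)
From HB Require Import structures.
From mathcomp Require Import all_boot all_order all_algebra.
From mathcomp Require Import all_classical all_reals all_analysis.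
From mathcomp Require Import measurable_realfun borel_hierarchy.

Set Implicit Arguments.
Unset Strict Implicit.
Unset Printing Implicit Defensive.
Import Order.TTheory GRing.Theory Num.Theory.
Import numFieldNormedType.Exports.

Local Open Scope classical_set_scope.
Local Open Scope ring_scope.

Record finite_filtration (d : measure_display) (T : measurableType d)
    (R : realType) (P : probability T R) := FiniteFiltration {
  sigma : nat -> set (set T);
  sigma_is_algebra : forall n, sigma_algebra [set: T] (sigma n);
  sigma_measurable : forall n, sigma n `<=` measurable;
  sigma_finite_set : forall n, finite_set (sigma n);
  sigma_increasing : forall n m, (n <= m)%N -> sigma n `<=` sigma m;
  atom : nat -> set (set T);
  atom_finite : forall n, finite_set (atom n);
  atom_partition : forall n, partition (atom n) id [set: T];
  sigma_atom : forall n, sigma n = <<s atom n >>;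
  atom_gt0 : forall n D, atom n D -> (0 < P D)%E;
  atom_split : forall n D, atom n D -> exists2 m, (n < m)%N & ~ atom m D
}.

Section martingales.
Context (d : measure_display) (T : measurableType d) (R : realType).
Context (P : probability T R) (F : finite_filtration P).
Implicit Types f : nat -> T -> R.

(* As every atom has positive probability, two [sigma F n]-measurable functions
   that agree almost surely are equal: the terms of a martingale are taken to
   be functions rather than almost sure classes. *)
Definition martingale f : Prop :=
  [/\ forall n, measurable_fun [set: g_sigma_algebraType (sigma F n)] (f n),
      forall n, f n \in Lfun P 1 &
      forall n m E, (n <= m)%N -> sigma F n E ->
        \int[P]_(w in E) (f n w)%:E = \int[P]_(w in E) (f m w)%:E]%E.

Definition mart_norm (p : \bar R) f : \bar R :=
  ereal_sup (range (fun n => 'N[P]_p[EFin \o f n]))%E.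

Definition Mpred (p : \bar R) : {pred nat -> T -> R} :=
  mem [set f | martingale f /\ (mart_norm p f < +oo)%E].

Lemma martingale_sigma f n B : martingale f -> measurable B ->
  sigma F n (f n @^-1` B).
Proof.
case=> mf _ _ mB; have := mf n measurableT B mB; rewrite setTI /measurable/=.
by rewrite (sigma_algebra_id (sigma_is_algebra F n)).
Qed.

Lemma martingale_mfun f n : martingale f -> measurable_fun [set: T] (f n).
Proof.
move=> mf _ B mB; rewrite setTI.
exact: (@sigma_measurable _ _ _ _ F n _ (martingale_sigma n mf mB)).
Qed.

Lemma sigma_atom_sub n A D : sigma F n A -> atom F n D ->
  D `<=` A \/ D `<=` ~` A.
Proof.
move=> + aD; rewrite sigma_atom => sA.
suff /(_ _ sA)/(_ _ aD) : <<s atom F n >> `<=`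
    [set B | forall E, atom F n E -> E `<=` B \/ E `<=` ~` B] by [].
apply: smallest_sub => [|B aB E aE]; first split.
- by move=> E _; right => w _ [].
- move=> B /= BE E /BE[EB|EB]; [right|left] => w /EB; first by move=> Bw [].
  by move=> ?; split.
- move=> B BE E aE; have [[k EB]|h] := pselect (exists k, E `<=` B k).
    by left=> w /EB; exists k.
  right=> w Ew [k _ Bw]; apply: h; exists k.
  by have [//|/(_ _ Ew)] := BE k E aE.
- have [EB|EB] := pselect (E `&` B !=set0).
    left; have [_ tr _] := atom_partition F n.
    by rewrite (tr E B aE aB EB).
  by right=> w Ew Bw; apply: EB; exists w.
Qed.

Lemma martingale_atom f n D v w : martingale f -> atom F n D ->
  D v -> D w -> f n v = f n w.
Proof.
move=> mf aD Dv Dw; have sA := martingale_sigma n mf (measurable_set1 (f n v)).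
have [/(_ _ Dw)//|/(_ _ Dv)] := sigma_atom_sub sA aD.
by move=> /(_ erefl).
Qed.

Lemma mart_norm_ge0 p f : (0 <= mart_norm p f)%E.
Proof.
apply: le_trans (ereal_sup_ubound (ex_intro2 _ _ 0%N I erefl)).
exact: Lnorm_ge0.
Qed.

Lemma LnormZ_mfun (p : \bar R) (a : R) (g : T -> R) : (1 <= p)%E ->
  measurable_fun [set: T] g -> ('N[P]_p[EFin \o g] < +oo)%E ->
  ('N[P]_p[EFin \o (a \*: g)%R] = `|a|%:E * 'N[P]_p[EFin \o g])%E.
Proof.
move=> p1 mg Ng; have gL : g \in Lfun P p by rewrite inE; apply/andP; rewrite !inE.
exact: (LnormZ (Lfun_Sub p1 gL)).
Qed.

Lemma mart_normZ (p : \bar R) (a : R) f : (1 <= p)%E -> f \in Mpred p ->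
  mart_norm p (a *: f)%R = (`|a|%:E * mart_norm p f)%E.
Proof.
move=> p1 /set_mem[mf Nf].
rewrite /mart_norm -ereal_supZl//; last first.
  by apply/set0P; exists ('N[P]_p[EFin \o f 0%N])%E, 0%N.
congr ereal_sup; rewrite image_comp; apply: eq_imagel => n _ /=.
apply: LnormZ_mfun => //; first exact: martingale_mfun.
by apply: le_lt_trans Nf; apply: ereal_sup_ubound; exists n.
Qed.

Lemma mart_normD (p : \bar R) f g : (1 <= p)%E -> martingale f -> martingale g ->
  (mart_norm p (f + g)%R <= mart_norm p f + mart_norm p g)%E.
Proof.
move=> p1 mf mg; apply: ge_ereal_sup => _ [n _ <-].
apply: le_trans (eminkowski _ (martingale_mfun n mf) (martingale_mfun n mg) p1) _.
by apply: leeD; apply: ereal_sup_ubound; exists n.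
Qed.

Lemma martingale0 : martingale 0.
Proof.
by split=> [n|n|//]; [exact: measurable_cst|exact: Lfun_cst].
Qed.

Lemma martingaleDZ a f g : martingale f -> martingale g -> martingale (a *: f + g).
Proof.
move=> [mf lf ef] [mg lg eg]; split=> [n|n|n m E nm sE].
- exact: measurable_funD (measurable_funM (measurable_cst _) (mf n)) (mg n).
- have le11 : (1 <= 1 :> \bar R)%E by [].
  have [_ C] := Lfun_submod_closed P le11.
  exact: (C a (f n) (g n) (lf n) (lg n)).
- have mE := sigma_measurable sE.
  have iE (h : nat -> T -> R) k : h k \in Lfun P 1 -> P.-integrable E (EFin \o h k).
    move=> /Lfun1_integrable; exact: integrableS.
  have H k : (\int[P]_(w in E) ((a *: f + g)%R k w)%:E =
      a%:E * \int[P]_(w in E) (f k w)%:E + \int[P]_(w in E) (g k w)%:E)%E.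
    rewrite -integralZl//; last exact: iE.
    rewrite -(integralD mE) //; last 2 first.
    + exact: (integrableZl mE a (iE f k (lf k))).
    + exact: iE.
  by rewrite !H (ef n m E nm sE) (eg n m E nm sE).
Qed.

Lemma Mpred_submod_closed (p : \bar R) : (1 <= p)%E -> submod_closed (Mpred p).
Proof.
move=> p1; split.
  apply: mem_set; split; first exact: martingale0.
  apply: (@le_lt_trans _ _ 0%E); last by [].
  apply: ge_ereal_sup => _ [n _ <-].
  by rewrite -[X in 'N[_]__[X]%E]/(cst 0%E) Lnorm0// gt_eqF// (lt_le_trans _ p1).
move=> a f g Mf /set_mem[mg Ng]; have [mf Nf] := set_mem Mf.
apply: mem_set; split; first exact: martingaleDZ.
apply: le_lt_trans (mart_normD p1 _ mg) _.
  by rewrite -[a *: f]addr0; exact: martingaleDZ martingale0.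
rewrite mart_normZ// lte_add_pinfty//.
by rewrite lte_mul_pinfty// lee_fin.
Qed.

Lemma mart_norm0_eq0 (p : \bar R) f : (1 <= p)%E -> martingale f ->
  mart_norm p f = 0%E -> f = 0.
Proof.
move=> p1 mf N0; apply/funext => n; apply/funext => w.
have [cov _ _] := atom_partition F n.
have [D aD Dw] : cover (atom F n) id w by rewrite cov.
have sD : sigma F n D by rewrite sigma_atom; exact: sub_sigma_algebra.
apply: contrapT => fw0.
have Nn : ('N[P]_p[EFin \o f n] = 0)%E.
  apply/eqP; rewrite eq_le Lnorm_ge0 andbT -N0.
  by apply: ereal_sup_ubound; exists n.
have /measurable_EFinP mfn := martingale_mfun n mf.
have ae0 := Lnorm_eq0_eq0 mfn (lt_le_trans lte01 p1) Nn.
have : P.-negligible D.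
  apply: negligibleS ae0 => v Dv /= /(_ I) -[fv0].
  by apply: fw0; rewrite (martingale_atom mf aD Dw Dv).
move=> /(measure_negligible (sigma_measurable sD)) PD0.
by have := atom_gt0 aD; rewrite PD0 ltxx.
Qed.

End martingales.

Record martspace (d : measure_display) (T : measurableType d) (R : realType)
    (P : probability T R) (F : finite_filtration P) (p : \bar R)
    (p1 : (1 <= p)%E) := Martspace {
  mart :> nat -> T -> R;
  martP : mart \in Mpred F p
}.

Section martspace_normed.
Context (d : measure_display) (T : measurableType d) (R : realType).
Context (P : probability T R) (F : finite_filtration P).
Context (p : \bar R) (p1 : (1 <= p)%E).
Local Notation M := (martspace F p1).

HB.instance Definition _ := [isSub for @mart _ _ _ _ F p p1].
HB.instance Definition _ := [Choice of M by <:].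
HB.instance Definition _ := GRing.isSubmodClosed.Build _ _ (Mpred F p)
  (Mpred_submod_closed F p1).
HB.instance Definition _ := [SubChoice_isSubLmodule of M by <:].

Definition martspace_norm (f : M) : R := fine (mart_norm P p f).

Lemma martspace_normE (f : M) : (martspace_norm f)%:E = mart_norm P p f.
Proof.
rewrite /martspace_norm fineK// ge0_fin_numE ?mart_norm_ge0//.
by have /set_mem[] := martP f.
Qed.

Lemma martspace_normD (f g : M) :
  martspace_norm (f + g) <= martspace_norm f + martspace_norm g.
Proof.
rewrite -lee_fin EFinD !martspace_normE.
have /set_mem[mf _] := martP f; have /set_mem[mg _] := martP g.
exact: mart_normD mf mg.
Qed.

Lemma martspace_normZ (a : R) (f : M) :
  martspace_norm (a *: f) = `|a| * martspace_norm f.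
Proof.
apply: EFin_inj; rewrite EFinM !martspace_normE.
exact: (mart_normZ a p1 (martP f)).
Qed.

Lemma martspace_norm0_eq0 (f : M) : martspace_norm f = 0 -> f = 0.
Proof.
move=> f0; apply: val_inj; have /set_mem[mf _] := martP f.
by apply: (mart_norm0_eq0 p1 mf); rewrite -martspace_normE f0.
Qed.

HB.instance Definition _ := Lmodule_isNormed.Build R M
  martspace_normD martspace_normZ martspace_norm0_eq0.

Definition uniformly_integrable : set M :=
  [set f | ereal_sup (range (fun n =>
       \int[P]_(w in [set w | (c < `|f n w|)%R]) `|f n w|%:E))%E
     @[c --> +oo] --> 0%E].

Definition ae_null : set M :=
  [set f | {ae P, forall w, f n w @[n --> \oo] --> (0 : R)}].

End martspace_normed.

Arguments uniformly_integrable {d T R P} F {p} p1.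
Arguments ae_null {d T R P} F {p} p1.

Section branches.
Context (d : measure_display) (T : measurableType d) (R : realType).
Context (P : probability T R) (F : finite_filtration P).

Definition branches : set (prod_topology
    (fun n : nat => discrete_topology (set_type (atom F n)))) :=
  [set x | forall n m, (n <= m)%N -> set_val (x m) `<=` set_val (x n)].

(* [f n] is constant on every atom of [sigma F n] (see [value_on_atom]); the
   default value of [xget] is never used there. *)
Definition value_on (g : T -> R) (D : set T) : R :=
  xget 0 [set r | forall w, D w -> g w = r].

Lemma value_on_atom (f : nat -> T -> R) n D w :
  martingale F f -> atom F n D -> D w -> value_on (f n) D = f n w.
Proof.
move=> mf aD Dw; rewrite /value_on.
case: xgetP => [r _ /(_ _ Dw)//|/(_ (f n w))[]].
by move=> v Dv; rewrite (martingale_atom mf aD Dv Dw).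
Qed.

Definition value_at (f : nat -> T -> R) (x : branches) (n : nat) : R :=
  value_on (f n) (set_val (set_val x n)).

Definition oscillates (f : nat -> T -> R) (x : branches) : Prop :=
  (limn_esup (fun n => (value_at f x n)%:E) = +oo /\
   limn_einf (fun n => (value_at f x n)%:E) = -oo)%E.

End branches.

Arguments branches {d T R P} F.

Definition dense_Gdelta (X : topologicalType) (A : set X) : Prop :=
  dense A /\ Gdelta A.

(* Main.v *)
Require Import Defs.
From HB Require Import structures.
From mathcomp Require Import all_boot all_order all_algebra.
From mathcomp Require Import all_classical all_reals all_analysis.
From mathcomp Require Import measurable_realfun borel_hierarchy.
From mathcomp Require Import ring lra.

Set Implicit Arguments.
Unset Strict Implicit.
Unset Printing Implicit Defensive.
Import Order.TTheory GRing.Theory Num.Theory.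
Import numFieldNormedType.Exports.

Local Open Scope classical_set_scope.
Local Open Scope ring_scope.

(** The theorem rests on a Baire category argument in [Y] and on a nested
    construction along the tree of atoms.

    Let [large s m D N] be the set of martingales [f] for which some [s * f n]
    with [n >= N] exceeds [N] at a point of the atom [D]. It is open, because
    evaluation at a point is norm continuous. It is dense in [Y]
    ([large_dense]): every atom splits again and again, so [D] contains
    arbitrarily many disjoint atoms of a common late level, and on one of them,
    [E], the function [N + 1 + |g|] has tiny [L^r] norm
    ([atom_small_integral]). Adding to [g] a martingale whose value on [E] has
    the sign [s] and this height moves [g] by little and into [large s m D N].
    Such a bump must not leave [Y] ([bump_stable]). For [M_p] and the uniformly
    integrable martingales it is a stopped branch martingale, which is bounded
    ([bounded_bump]); for the almost surely null martingales it is the density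
    martingale of a point mass at a branch of vanishing measure ([null_bump]).

    Each [Y] is a closed subset of a complete space. Completeness of [M_p]
    follows from uniform convergence on each level ([martspace_complete]);
    uniform integrability is closed because tails are subadditive up to a factor
    ([tail_le]), almost sure nullity because of Doob's maximal inequality
    ([martingale_maximal]). As there are countably many atoms, the martingales
    lying in all sets [large] form a dense G-delta set [G] ([baire_subset]).

    For [f] in [G], nested atoms on which [f] takes alternately large positive
    and large negative values end in a branch along which [f] oscillates, and
    they can start from any atom, so these branches are dense
    ([large_oscillates]). Finally, oscillation is a countable intersection of
    conditions that are open in the pair of martingale and branch
    ([open_oscillates_beyond]). *)

(** * Atoms and branches *)

Section atoms.
Context (d : measure_display) (T : measurableType d) (R : realType).
Context (P : probability T R) (F : finite_filtration P).
Implicit Types (n m : nat) (D E : set T) (w : T).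

Lemma atom_sigma n D : atom F n D -> sigma F n D.
Proof. by move=> aD; rewrite sigma_atom; exact: sub_sigma_algebra. Qed.

Lemma atom_measurable n D : atom F n D -> measurable D.
Proof. by move=> /atom_sigma; exact: sigma_measurable. Qed.

Lemma atom_nonempty n D : atom F n D -> D !=set0.
Proof. by have [_ _ h] := atom_partition F n => /h. Qed.

Lemma atom_cover n w : exists2 D, atom F n D & D w.
Proof.
have [cov _ _] := atom_partition F n.
by have [D aD Dw] : cover (atom F n) id w by [rewrite cov]; exists D.
Qed.

Lemma atom_unique n D E w : atom F n D -> atom F n E -> D w -> E w -> D = E.
Proof.
case: (atom_partition F n) => _ tr _ aD aE Dw Ew.
by apply: (tr D E aD aE); exists w.
Qed.

Lemma atom_sub n m D E w : (n <= m)%N -> atom F n D -> atom F m E ->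
  D w -> E w -> E `<=` D.
Proof.
move=> nm aD aE Dw Ew.
have sD := sigma_increasing nm (atom_sigma aD).
by have [//|/(_ _ Ew)] := sigma_atom_sub sD aE.
Qed.

Definition atom_of n w : set T := xget set0 [set D | atom F n D /\ D w].

Lemma atom_ofP n w : atom F n (atom_of n w) /\ atom_of n w w.
Proof.
have [D aD Dw] := atom_cover n w.
exact: (@xgetI _ set0 [set D | atom F n D /\ D w] D).
Qed.

Lemma atom_ofE n D w : atom F n D -> D w -> atom_of n w = D.
Proof.
move=> aD Dw; have [aA Aw] := atom_ofP n w.
exact: atom_unique aA aD Aw Dw.
Qed.

Lemma atom_child n m D : (n <= m)%N -> atom F n D ->
  exists2 E, atom F m E & E `<=` D.
Proof.
move=> nm aD; have [w Dw] := atom_nonempty aD.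
have [E aE Ew] := atom_cover m w; exists E => //.
exact: atom_sub nm aD aE Dw Ew.
Qed.

Lemma atom_split2 n D : atom F n D -> exists m E1 E2, [/\ (n < m)%N,
  atom F m E1 /\ E1 `<=` D, atom F m E2 /\ E2 `<=` D & E1 `&` E2 = set0].
Proof.
move=> aD; have [m nm naD] := atom_split aD.
have [E aE ED] := atom_child (ltnW nm) aD.
have [v [Dv nEv]] : exists v, D v /\ ~ E v.
  apply: contrapT => h; apply: naD; suff -> : D = E by [].
  apply/seteqP; split=> // v Dv; apply: contrapT => nEv; apply: h.
  by exists v.
have [E' aE' E'v] := atom_cover m v.
exists m, E, E'; split=> //.
  by split=> //; exact: atom_sub (ltnW nm) aD aE' Dv E'v.
apply/seteqP; split=> // u [Eu E'u]; apply: nEv.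
by rewrite (atom_unique aE aE' Eu E'u).
Qed.

(** By induction on [M]: when [D] splits, one of two disjoint subatoms is
    divided into [M] pieces and the other one supplies the last piece. *)
Lemma many_atoms n D N (M : nat) : atom F n D -> exists m (E : nat -> set T),
  [/\ (N <= m)%N, forall i, (i < M)%N -> atom F m (E i) /\ E i `<=` D
    & trivIset `I_M E].
Proof.
elim: M n D N => [|M IH] n D N aD.
  exists N, (fun=> set0); split => // i j [].
have [m [E1 [E2 [nm [a1 s1] [a2 s2] E12]]]] := atom_split2 aD.
have [k [E [mk aE tE]]] := IH m E1 (maxn N m) a1.
move: mk; rewrite geq_max => /andP[Nk mk].
have [E' aE' E'E2] := atom_child mk a2.
have dis i v : (i < M)%N -> E i v -> E' v -> False.
  move=> iM Eiv E'v; have : (E1 `&` E2) v.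
    by split; [exact: (aE i iM).2|exact: E'E2].
  by rewrite E12.
exists k, (fun i => if i == M then E' else E i); split => //.
- move=> i; rewrite ltnS leq_eqVlt => /predU1P[->|iM].
    by rewrite eqxx; split=> //; exact: subset_trans s2.
  rewrite lt_eqF//; have [? ?] := aE i iM.
  by split=> //; exact: subset_trans s1.
- move=> i j /=; rewrite !ltnS.
  rewrite (leq_eqVlt i) => /predU1P[->|iM].
    rewrite eqxx (leq_eqVlt j) => /predU1P[->//|jM].
    by rewrite lt_eqF// => -[v [E'v Ejv]]; have := dis _ _ jM Ejv E'v.
  rewrite lt_eqF// (leq_eqVlt j) => /predU1P[->|jM].
    by rewrite eqxx => -[v [Eiv E'v]]; have := dis _ _ iM Eiv E'v.
  by rewrite lt_eqF//; exact: tE.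
Qed.

Lemma atom_half n D : atom F n D -> exists m E,
  [/\ (n < m)%N, atom F m E, E `<=` D & fine (P E) <= fine (P D) / 2].
Proof.
move=> aD; have [m [E1 [E2 [nm [a1 s1] [a2 s2] E12]]]] := atom_split2 aD.
have mD := atom_measurable aD; have m1 := atom_measurable a1.
have m2 := atom_measurable a2.
have : fine (P E1) + fine (P E2) <= fine (P D).
  rewrite -fineD ?fin_num_measure// -measureU//.
  rewrite fine_le ?fin_num_measure//; first exact: measurableU.
  apply: le_measure; rewrite ?inE//; first exact: measurableU.
  by rewrite subUset.
have [le12 le|/ltW le21 le] := leP (fine (P E1)) (fine (P E2)).
- exists m, E1; split=> //; rewrite ler_pdivlMr// mulr_natr mulr2n.
  by apply: le_trans le; rewrite lerD2l.
- exists m, E2; split=> //; rewrite ler_pdivlMr// mulr_natr mulr2n.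
  by apply: le_trans le; rewrite lerD2r.
Qed.

Definition branch (A : nat -> set T) :=
  (forall n, atom F n (A n)) /\ (forall n m, (n <= m)%N -> A m `<=` A n).

Lemma branch_atom_of w : branch (atom_of ^~ w).
Proof.
split=> [n|n m nm]; first exact: (atom_ofP n w).1.
have [an nw] := atom_ofP n w; have [am mw] := atom_ofP m w.
exact: atom_sub nm an am nw mw.
Qed.

Lemma nested_sub (D : nat -> set T) : (forall j, D j.+1 `<=` D j) ->
  forall i j, (i <= j)%N -> D j `<=` D i.
Proof.
move=> sD i j /subnKC <-; elim: (j - i)%N => [|k IH]; first by rewrite addn0.
by rewrite addnS; exact: subset_trans IH.
Qed.

(** The [n]-th atom of the branch is the one containing a chosen point of
    [D n]. As [D n] is an atom of level at least [n], that atom is the same for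
    every point of [D n], hence for the points chosen in the later [D j]. *)
Lemma nested_branch (k : nat -> nat) (D : nat -> set T) :
  (forall j, (j <= k j)%N) -> (forall j, atom F (k j) (D j)) ->
  (forall j, D j.+1 `<=` D j) ->
  exists2 A, branch A & forall j, A (k j) = D j.
Proof.
move=> jk aD /nested_sub sD.
have /choice[w Dw] j : exists w, D j w by exact: atom_nonempty (aD j).
have same n j v : (n <= j)%N -> D j v -> atom_of n v = atom_of n (w n).
  move=> nj /(sD _ _ nj) Dv; have [an nw] := atom_ofP n (w n).
  apply: atom_ofE => //; apply: (atom_sub (jk n) an (aD n) nw) => //; exact: Dw.
exists (fun n => atom_of n (w n)) => [|j].
  split=> [n|n m nm]; first exact: (atom_ofP n (w n)).1.
  rewrite -(same n m (w m) nm (Dw m)).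
  by have [_ h] := branch_atom_of (w m); exact: h.
apply: atom_ofE => //; exact: sD (Dw _).
Qed.

(** Each split leaves a subatom of at most half the measure; following these
    subatoms makes the measures along the branch tend to zero. *)
Lemma branch_null n D : atom F n D -> exists A, [/\ branch A, A n = D &
  forall e : R, 0 < e -> exists k, fine (P (A k)) < e].
Proof.
move=> aD.
pose good (x : nat * set T) := atom F x.1 x.2.
have /choice[next nextP] (x : nat * set T) : exists y : nat * set T,
    good x -> [/\ (x.1 < y.1)%N, good y, y.2 `<=` x.2 &
      fine (P y.2) <= fine (P x.2) / 2].
  have [gx|] := pselect (good x); last by exists x.
  by have [m [E [? ? ? ?]]] := atom_half gx; exists (m, E).
pose s j := iter j next (n, D).
have gs j : good (s j) by elim: j => // j IH; rewrite /s iterS; case: (nextP _ IH).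
have jk j : (j <= (s j).1)%N.
  elim: j => // j IH; have [+ _ _ _] := nextP _ (gs j).
  by move=> /(leq_ltn_trans IH); rewrite /s iterS.
have sub j : (s j.+1).2 `<=` (s j).2 by have [_ _ + _] := nextP _ (gs j).
have [A bA AD] := nested_branch jk gs sub.
exists A; split=> //; first exact: (AD 0%N).
move=> e e0.
have half j : fine (P (s j).2) <= 2^-1 ^+ j.
  elim: j => [|j IH].
    rewrite expr0; have /atom_measurable mD := aD.
    by rewrite -lee_fin fineK ?fin_num_measure// probability_le1.
  have [_ _ _ le] := nextP _ (gs j); apply: (le_trans le).
  by rewrite exprSr ler_pM2r// invr_gt0.
have : (2^-1 : R) ^+ j @[j --> \oo] --> (0 : R).
  by apply: cvg_expr; rewrite gtr0_norm// invf_lt1// ltr1n.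
move=> /cvgr0Pnorm_lt/(_ e e0)[j _ /(_ j (leqnn j))/=].
rewrite ger0_norm ?exprn_ge0// => lt.
by exists (s j).1; rewrite AD; exact: le_lt_trans (half j) lt.
Qed.

End atoms.
Arguments atom_of {d T R P} F.
Arguments branch {d T R P} F.

(** * Martingales carried by a branch *)

Section branch_martingale.
Context (d : measure_display) (T : measurableType d) (R : realType).
Context (P : probability T R) (F : finite_filtration P).
Implicit Types (n m k : nat) (A : nat -> set T) (c r : R).

Lemma atom_fine_gt0 n D : atom F n D -> 0 < fine (P D).
Proof.
move=> aD; apply: fine_gt0; rewrite (atom_gt0 aD)/=.
by rewrite -ge0_fin_numE// fin_num_measure//; exact: atom_measurable aD.
Qed.

Lemma fine_prob_le (D E : set T) : measurable D -> measurable E ->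
  D `<=` E -> fine (P D) <= fine (P E).
Proof.
by move=> mD mE DE; rewrite fine_le ?fin_num_measure// le_measure ?inE.
Qed.

(** The density martingale of the mass [c] sitting at the end of the branch. *)
Definition branch_mart A c n : T -> R := (c / fine (P (A n))) \*: \1_(A n).

Lemma branch_martE A c n w :
  branch_mart A c n w = c / fine (P (A n)) * (w \in A n)%:R.
Proof. by rewrite /branch_mart/= indicE. Qed.

Lemma integral_branch_mart A c n (E : set T) : branch F A -> measurable E ->
  (\int[P]_(w in E) (branch_mart A c n w)%:E =
   (c / fine (P (A n)) * fine (P (A n `&` E)))%:E)%E.
Proof.
move=> [aA _] mE; have mA := atom_measurable (aA n).
under eq_integral do rewrite /branch_mart/= EFinM.
rewrite integralZl//; last first.
  by apply: integrableS (integrable_indic P mA).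
rewrite integral_indic// [RHS]EFinM fineK// fin_num_measure//.
exact: measurableI.
Qed.

Lemma branch_martingale A c : branch F A -> martingale F (branch_mart A c).
Proof.
move=> bA; have [aA sA] := bA; split=> [n|n|n m E nm sE].
- apply: measurable_funM; first exact: measurable_cst.
  apply: measurable_indic; apply: sub_sigma_algebra; exact: atom_sigma (aA n).
- apply/Lfun1_integrable; have mA := atom_measurable (aA n).
  rewrite (_ : _ \o _ = fun w => ((c / fine (P (A n)))%:E * (\1_(A n) w)%:E)%E).
    by apply: integrableZl => //; exact: integrable_indic.
  by apply/funext => w; rewrite /branch_mart/= EFinM.
- have mE := sigma_measurable sE; rewrite !integral_branch_mart//.
  have gt0 k := atom_fine_gt0 (aA k).
  have [AE|AE] := sigma_atom_sub sE (aA n).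
    rewrite !setIidl//; last exact: subset_trans (sA n m nm) AE.
    by rewrite !mulfVK// gt_eqF.
  have AmE : A m `<=` ~` E by exact: subset_trans (sA n m nm) AE.
  rewrite (disjoints_subset _ _).2// (disjoints_subset (A m) _).2//.
  by rewrite measure0 !mulr0.
Qed.

Lemma martingale_stop f n : martingale F f -> martingale F (fun k => f (minn k n)).
Proof.
move=> [mf lf ef]; split=> [k|k//|k m E km sE].
- move=> _ B mB; have := mf (minn k n) measurableT B mB.
  rewrite !setTI /measurable/=.
  rewrite !(sigma_algebra_id (sigma_is_algebra F _)).
  by apply: sigma_increasing; exact: geq_minl.
- have [kn|nk] := leqP k n => /=.
    by apply: ef => //; rewrite leq_min km kn.
  by rewrite (minn_idPr (leq_trans (ltnW nk) km)).
Qed.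

Lemma Lnorm_indic r (D : set T) : 0 < r -> measurable D ->
  ('N[P]_r%:E[EFin \o \1_D] = (fine (P D) `^ r^-1)%:E)%E.
Proof.
move=> r0 mD; rewrite unlock -poweR_EFin fineK ?fin_num_measure//; congr poweR.
rewrite -[in RHS](setIT D) -integral_indic//; apply: eq_integral => w _ /=.
rewrite indicE; case: (w \in D) => /=; first by rewrite normr1 powR1.
by rewrite normr0 powR0// gt_eqF.
Qed.

Lemma Lnorm_branch_mart A c r n : branch F A -> 1 <= r ->
  ('N[P]_r%:E[EFin \o branch_mart A c n] =
   (`|c| / fine (P (A n)) * fine (P (A n)) `^ r^-1)%:E)%E.
Proof.
move=> [aA _] r1; have r0 := lt_le_trans ltr01 r1.
have mA := atom_measurable (aA n).
rewrite LnormZ_mfun//; last by rewrite Lnorm_indic// ltry.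
by rewrite Lnorm_indic// -EFinM normrM normfV (ger0_norm (fine_ge0 _)).
Qed.

Lemma div_powR_le (x y s : R) : 0 < x -> x <= y -> s <= 1 ->
  x / y * y `^ s <= x `^ s.
Proof.
move=> x0 xy s1; have y0 := lt_le_trans x0 xy.
have xy01 : 0 < x / y <= 1 by rewrite divr_gt0// ler_pdivrMr// mul1r.
apply: le_trans (ler_wpM2r (powR_ge0 _ _) (ger1_powR xy01 s1)) _.
have xy0 := divr_ge0 (ltW x0) (ltW y0).
rewrite -powRM//; last exact: ltW.
by rewrite mulfVK// gt_eqF.
Qed.

(** The branch martingale with value [c] on [A n] has at level [k] the norm
    [|c| * P (A n) * P (A k) ^ (1 / r - 1)]. As [1 / r - 1 <= 0] and [P (A k)]
    decreases, this is largest at [k = n]. *)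
Lemma Lnorm_branch_mart_le A c r n k : branch F A -> 1 <= r -> (k <= n)%N ->
  ('N[P]_r%:E[EFin \o branch_mart A (c * fine (P (A n))) k] <=
   (`|c| * fine (P (A n)) `^ r^-1)%:E)%E.
Proof.
move=> bA r1 kn; have [aA sA] := bA; rewrite Lnorm_branch_mart// lee_fin.
have Pn0 := atom_fine_gt0 (aA n).
rewrite normrM (gtr0_norm Pn0) -!mulrA ler_wpM2l// mulrA.
apply: div_powR_le => //.
  by apply: fine_prob_le (sA _ _ kn); exact: atom_measurable (aA _).
by rewrite invf_le1// (lt_le_trans ltr01).
Qed.

End branch_martingale.

Section bumps.
Context (d : measure_display) (T : measurableType d) (R : realType).
Context (P : probability T R) (F : finite_filtration P).

Lemma martspace_lift (p : \bar R) (p1 : (1 <= p)%E) f (a : R) :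
  martingale F f -> (forall n, 'N[P]_p[EFin \o f n] <= a%:E)%E ->
  exists h : martspace F p1, (h = f :> (nat -> T -> R)) /\ `|h| <= a.
Proof.
move=> mf fa; have Na : (mart_norm P p f <= a%:E)%E.
  by apply: ge_ereal_sup => _ [n _ <-].
have Mf : f \in Mpred F p.
  by apply: mem_set; split=> //; exact: le_lt_trans Na (ltry _).
exists (Martspace p1 Mf); split=> //.
by rewrite -lee_fin (martspace_normE (Martspace p1 Mf)).
Qed.

(** The bound on [h] is the [L^r] norm of [c * \1_E], the least norm that a
    martingale with the value [c] on [E] can have. *)
Definition bump_stable (r : R) (p1 : (1 <= r%:E)%E)
    (Y : set (martspace F p1)) :=
  forall n E c, atom F n E -> exists h : martspace F p1,
    [/\ forall g, Y g -> Y (g + h), `|h| <= `|c| * fine (P E) `^ r^-1 &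
        forall w, E w -> h n w = c].

(** A branch martingale stopped at level [n] no longer changes after [n], so it
    is bounded in time as well. *)
Lemma bounded_bump (r : R) (p1 : (1 <= r%:E)%E) n E c : atom F n E ->
  exists h : martspace F p1, [/\ exists B, forall k w, `|h k w| <= B,
    `|h| <= `|c| * fine (P E) `^ r^-1 & forall w, E w -> h n w = c].
Proof.
move=> aE; have r1 : 1 <= r by rewrite -lee_fin.
have [w0 Ew0] := atom_nonempty aE; have bA := branch_atom_of F w0.
set A := fun n => _ in bA; have AE : A n = E by exact: atom_ofE.
have [aA sA] := bA; have PE := atom_fine_gt0 aE.
pose f := branch_mart P A (c * fine (P E)).
have [|k|h [hf hn]] := @martspace_lift _ p1 (fun k => f (minn k n))
  (`|c| * fine (P E) `^ r^-1).
- by apply: martingale_stop; exact: branch_martingale.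
- by rewrite /f -AE; apply: Lnorm_branch_mart_le => //; exact: geq_minr.
exists h; split => //; last first.
  move=> w Ew; rewrite hf minnn /f branch_martE AE mem_set//.
  by rewrite mulr1 mulfK// gt_eqF.
exists `|c| => k w; rewrite hf /f branch_martE.
have PA j := atom_fine_gt0 (aA j).
rewrite normrM -[leRHS]mulr1 ler_pM//; last first.
  by case: (_ \in _); rewrite ?normr1 ?normr0.
rewrite normrM normfV normrM (gtr0_norm PE) (gtr0_norm (PA _)) ler_pdivrMr//.
rewrite ler_wpM2l// -AE fine_prob_le//; try exact: atom_measurable (aA _).
by apply: sA; exact: geq_minr.
Qed.

(** Along a branch whose measures tend to zero, the branch martingale belongs
    to a point mass singular to [P]: it vanishes from some level on outside
    the null intersection of the branch. *)
Lemma null_bump (p1 : (1 <= 1%:E :> \bar R)%E) n E c : atom F n E ->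
  exists h : martspace F p1, [/\ ae_null F p1 h,
    `|h| <= `|c| * fine (P E) `^ 1^-1 & forall w, E w -> h n w = c].
Proof.
move=> aE; have [A [bA AE null]] := branch_null aE.
have [aA sA] := bA; have PE := atom_fine_gt0 aE.
pose f := branch_mart P A (c * fine (P E)).
have [|k|h [hf hn]] := @martspace_lift _ p1 f (`|c| * fine (P E) `^ 1^-1).
- exact: branch_martingale.
- have PA := atom_fine_gt0 (aA k).
  rewrite (Lnorm_branch_mart _ _ bA)// lee_fin invr1.
  rewrite (powRr1 (ltW PA)) (powRr1 (ltW PE)).
  by rewrite mulfVK ?gt_eqF// normrM (gtr0_norm PE).
exists h; split => //; last first.
  move=> w Ew; rewrite hf /f branch_martE AE mem_set//.
  by rewrite mulr1 mulfK// gt_eqF.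
have mA k := atom_measurable (aA k).
have mN : measurable (\bigcap_k A k) by exact: bigcapT_measurable.
exists (\bigcap_k A k); split=> //.
  apply/eqP; rewrite eq_le measure_ge0 andbT; apply/lee_addgt0Pr => e e0.
  have [k ke] := null e e0; rewrite add0e.
  apply: (@le_trans _ _ (P (A k))).
    by rewrite le_measure ?inE//; exact: bigcap_inf.
  by rewrite -(@fineK _ (P (A k))) ?fin_num_measure// lee_fin ltW.
move=> w /= nconv; apply: contrapT => /existsNP[k /not_implyP[_ nAk]].
apply: nconv; rewrite hf; apply: cvg_near_cst.
exists k => // m /= km; rewrite /f branch_martE memNset ?mulr0//.
by move=> /(sA _ _ km).
Qed.

End bumps.
Arguments bump_stable {d T R P} F {r} p1.

(** * Values on atoms and completeness *)

Section values.
Context (d : measure_display) (T : measurableType d) (R : realType).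
Context (P : probability T R) (F : finite_filtration P).
Implicit Types (n m : nat) (D E : set T).

(** Among many disjoint atoms of one level, some atom carries little of the
    mass of [u] at that level, as the total mass is bounded by [C]. *)
Lemma atom_small_integral (u : nat -> T -> R) (C e : R) n D N :
  (forall m, measurable_fun [set: T] (u m)) -> (forall m w, 0 <= u m w) ->
  (forall m, \int[P]_w (u m w)%:E <= C%:E)%E -> 0 < e -> atom F n D ->
  exists m E, [/\ (N <= m)%N, atom F m E, E `<=` D &
                  (\int[P]_(w in E) (u m w)%:E < e%:E)%E].
Proof.
move=> mu u0 uC e0 aD; have [M CM] : exists M, C / e < M%:R.
  by exists (Num.truncn (C / e)).+1; exact: truncnS_gt.
have [m [E [Nm aE tE]]] := many_atoms N M aD.
apply: contrapT => h.
have big i : (i < M)%N -> (e%:E <= \int[P]_(w in E i) (u m w)%:E)%E.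
  move=> iM; rewrite leNgt; apply/negP => lt; apply: h.
  by have [aEi EiD] := aE i iM; exists m, (E i).
pose E' i := if (i < M)%N then E i else set0.
have mE' i : measurable (E' i).
  rewrite /E'; case: ltnP => // iM.
  by have [/atom_measurable] := aE i iM.
have tE' : trivIset [set` iota 0 M] E'.
  move=> i j /=; rewrite !mem_iota !add0n /E' => /andP[_ iM] /andP[_ jM].
  by rewrite iM jM; exact: tE.
have meu : measurable_fun [set: T] (EFin \o u m) by exact/measurable_EFinP.
have := @ge0_integral_bigsetU _ _ _ P _ E' (EFin \o u m) (iota 0 M) mE'
  (iota_uniq _ _) tE' (measurable_funS measurableT (@subsetT _ _) meu).
move=> /(_ (fun w _ => u0 m w)) sumE.
have : (\sum_(i <- iota 0 M) e%:E <= C%:E)%E.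
  apply: (@le_trans _ _ (\sum_(i <- iota 0 M) \int[P]_(w in E' i) (u m w)%:E)%E).
    rewrite big_seq [leRHS]big_seq; apply: lee_sum => i.
    by rewrite mem_iota add0n /E' => /= iM; rewrite iM; exact: big.
  rewrite -sumE; apply: le_trans (uC m).
  apply: ge0_subset_integral => //; last by move=> w _; rewrite lee_fin.
  exact: bigsetU_measurable.
rewrite sumEFin lee_fin big_const_seq count_predT size_iota iter_addr_0.
apply/negP; rewrite -ltNge -mulr_natl -ltr_pdivrMr//.
Qed.

Context (r : R) (p1 : (1 <= r%:E)%E).
Local Notation M := (martspace F p1).

Let r1 : 1 <= r. Proof. by rewrite -lee_fin. Qed.
Let r0 : 0 < r. Proof. exact: lt_le_trans ltr01 r1. Qed.

Lemma martspace_mart (f : M) : martingale F f.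
Proof. by have /set_mem[mf _] := martP f. Qed.

Lemma martspace_mfun (f : M) n : measurable_fun [set: T] (f n).
Proof. exact: martingale_mfun n (martspace_mart f). Qed.

Lemma Lnorm_martspace (f : M) n : ('N[P]_r%:E[EFin \o f n] <= `|f|%:E)%E.
Proof. by rewrite (martspace_normE f); apply: ereal_sup_ubound; exists n. Qed.

Lemma integral_powR_atom (u : T -> R) c D : measurable D ->
  (forall w, D w -> u w = c) ->
  (\int[P]_(w in D) (`|u w| `^ r)%:E = (`|c| `^ r * fine (P D))%:E)%E.
Proof.
move=> mD uc; rewrite (eq_integral (cst (`|c| `^ r)%:E)); last first.
  by move=> w /set_mem Dw; rewrite uc.
by rewrite integral_cst// EFinM fineK ?fin_num_measure.
Qed.

Lemma integral_powR_le (u : T -> R) C : ('N[P]_r%:E[EFin \o u] <= C%:E)%E ->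
  (\int[P]_w (`|u w| `^ r)%:E <= (C `^ r)%:E)%E.
Proof.
move=> uC; have := poweR_Lnorm P (EFin \o u) (lt0r_neq0 r0).
rewrite /= => <-; rewrite -poweR_EFin; apply: gt0_ler_poweR => //.
- exact: ltW.
- by rewrite in_itv/= leey Lnorm_ge0.
- by rewrite in_itv/= leey (le_trans _ uC)// Lnorm_ge0.
Qed.

Lemma powRK (x s : R) : s != 0 -> 0 <= x -> (x `^ s^-1) `^ s = x.
Proof. by move=> s0 x0; rewrite -powRrM mulVf// powRr1. Qed.

Lemma martspace_value_le (f : M) n D w : atom F n D -> D w ->
  `|f n w| * fine (P D) `^ r^-1 <= `|f|.
Proof.
move=> aD Dw; have mD := atom_measurable aD; rewrite leNgt; apply/negP => lt.
have := gt0_ltr_powR r0; rewrite /= => /(_ `|f| (`|f n w| * fine (P D) `^ r^-1)).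
rewrite !nnegrE => /(_ (normr_ge0 _) _ lt).
rewrite mulr_ge0 ?powR_ge0// => /(_ isT); apply/negP; rewrite -leNgt.
rewrite powRM ?powR_ge0// powRK ?gt_eqF ?fine_ge0//.
rewrite -lee_fin; apply: le_trans (integral_powR_le (Lnorm_martspace f n)).
rewrite -(@integral_powR_atom (f n) (f n w) D)//; last first.
  by move=> v Dv; exact: martingale_atom (martspace_mart f) aD Dv Dw.
apply: ge0_subset_integral => //.
- apply/measurable_EFinP; apply: (measurableT_comp (measurable_powR _)).
  by apply: measurableT_comp => //; exact: martspace_mfun.

Qed.

Lemma finite_set_ubound (I : Type) (A : set I) (g : I -> R) :
  finite_set A -> exists2 C, 0 <= C & forall i, A i -> g i <= C.
Proof.
elim/Pchoice: I => I in A g *.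
move=> /finite_seqP[s ->]; elim: s => [|i s [C C0 IH]]; first by exists 0.
exists (Num.max C (g i)); first by rewrite le_max C0.
move=> j; rewrite /= inE => /predU1P[->|js]; first by rewrite le_max lexx orbT.
by rewrite le_max (IH j js).
Qed.

(** The constant is uniform because a level has finitely many atoms. *)
Lemma martspace_value_bound n :
  exists2 C, 0 <= C & forall (f : M) w, `|f n w| <= C * `|f|.
Proof.
have [C C0 CP] := finite_set_ubound (fun D => (fine (P D) `^ r^-1)^-1)
  (atom_finite F n).
exists C => // f w; have [D aD Dw] := atom_cover F n w.
have PD : 0 < fine (P D) `^ r^-1 by rewrite powR_gt0// (atom_fine_gt0 aD).
apply: le_trans (ler_wpM2r (normr_ge0 f) (CP D aD)).
by rewrite ler_pdivlMl// mulrC; exact: martspace_value_le.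
Qed.

Lemma Lnorm_le_sup (u : T -> R) c : measurable_fun [set: T] u ->
  (forall w, `|u w| <= c) -> ('N[P]_r%:E[EFin \o u] <= c%:E)%E.
Proof.
move=> mu uc; have c0 : 0 <= c := le_trans (normr_ge0 _) (uc point).
rewrite unlock.
have -> : c%:E = ((c `^ r)%:E `^ r^-1)%E.
  by rewrite poweR_EFin -powRrM divff ?gt_eqF// powRr1.
apply: gt0_ler_poweR.
- by rewrite invr_ge0 ltW.
- rewrite in_itv/= leey andbT; apply: integral_ge0 => w _ /=.
  by rewrite lee_fin powR_ge0.
- by rewrite in_itv/= leey andbT lee_fin powR_ge0.
rewrite -[leRHS]mule1 -(@probability_setT _ _ _ P) -integral_cst//.
apply: ge0_le_integral => //.
- by move=> w _ /=; rewrite lee_fin powR_ge0.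
- apply/measurable_EFinP; apply: (measurableT_comp (measurable_powR _)).
  exact: measurableT_comp.
- by move=> w _ /=; rewrite lee_fin; apply: ge0_ler_powR => //; exact: ltW.
Qed.

Lemma martspaceDE (f g : M) n w : (f + g) n w = f n w + g n w.
Proof. by []. Qed.

Lemma martspaceBE (f g : M) n w : (f - g) n w = f n w - g n w.
Proof. by []. Qed.

(** At each level the norm controls the values uniformly, so [g] converges
    uniformly there. The martingale identities pass to the limit by dominated
    convergence, and the norm bounds by Minkowski's inequality through a late
    term [g j]. *)
Lemma martspace_complete (g : nat -> M) (rad : nat -> R) :
  rad @ \oo --> 0 -> (forall k l, (k <= l)%N -> `|g l - g k| <= rad k) ->
  exists f : M, forall k, `|f - g k| <= rad k.
Proof.
move=> rad0 gc.
have rad_ge0 k : 0 <= rad k by exact: le_trans (normr_ge0 _) (gc k k (leqnn k)).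
have /choice[C CP] n : exists C, 0 <= C /\ forall (f : M) w, `|f n w| <= C * `|f|.
  by have [C C0 CP] := martspace_value_bound n; exists C.
have C0 n := (CP n).1.
have gC n w k l : (k <= l)%N -> `|g l n w - g k n w| <= C n * rad k.
  move=> kl; rewrite -martspaceBE; apply: le_trans ((CP n).2 _ _) _.
  by rewrite ler_wpM2l// gc.
have Crad n : C n * rad k @[k --> \oo] --> 0.
  by rewrite -(mulr0 (C n)); apply: cvgM rad0; exact: cvg_cst.
have lim n w : exists y : R, g k n w @[k --> \oo] --> y.
  apply/cvg_ex; apply: cauchy_cvg; apply: cauchy_exP => e e0.
  have /cvgr0Pnorm_lt/(_ e e0)[k _ /(_ k (leqnn k))/=] := Crad n.
  rewrite ger0_norm ?mulr_ge0// => ke.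
  exists (g k n w), k => // l /= kl; rewrite /ball/= distrC.
  exact: le_lt_trans (gC n w k l kl) ke.
have /choice[f fP] (nw : nat * T) : exists y : R,
    g k nw.1 nw.2 @[k --> \oo] --> y by exact: lim.
pose f' n w := f (n, w).
have f'g n w k : `|f' n w - g k n w| <= C n * rad k.
  have : `|g l n w - g k n w| @[l --> \oo] --> `|f' n w - g k n w|.
    by apply: cvg_norm; apply: cvgB (fP (n, w)) _; exact: cvg_cst.
  move=> /cvgr_to_le; apply; exists k => // l /= kl; exact: gC.
have mf' n : measurable_fun [set: T] (f' n).
  by apply: measurable_fun_cvg (fun w _ => fP (n, w)) => k; exact: martspace_mfun.
pose dom n w : \bar R := (`|g 0%N n w| + C n * rad 0%N)%:E.
have idom n : P.-integrable [set: T] (dom n).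
  rewrite (_ : dom n = (fun w => `|(g 0%N n w)%:E| + (C n * rad 0%N)%:E)%E)//.
  apply: integrableD => //; last exact: finite_measure_integrable_cst.
  apply: integrable_abse; apply/Lfun1_integrable.
  by have [_ lg _] := martspace_mart (g 0%N); exact: lg.
have gdom n w k : (`|(g k n w)%:E| <= dom n w)%E.
  rewrite /dom lee_fin -[g k n w](subrK (g 0%N n w)) addrC.
  by apply: le_trans (ler_normD _ _) _; rewrite lerD2l gC.
have fdom n w : (`|(f' n w)%:E| <= dom n w)%E.
  rewrite /dom lee_fin -[f' n w](subrK (g 0%N n w)) addrC.
  by apply: le_trans (ler_normD _ _) _; rewrite lerD2l f'g.
have if' n : P.-integrable [set: T] (EFin \o f' n).
  apply: le_integrable (idom n) => //; first exact/measurable_EFinP.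
  by move=> w _; apply: le_trans (fdom n w) _; exact: lee_abs.
have conv n (E : set T) : measurable E ->
    (\int[P]_(w in E) (g k n w)%:E @[k --> \oo] --> \int[P]_(w in E) (f' n w)%:E)%E.
  move=> mE; have [] // := @dominated_convergence _ _ _ P E mE
    (fun k w => (g k n w)%:E) (EFin \o f' n) (dom n).
  - move=> k; apply/measurable_EFinP.
    exact: measurable_funS (martspace_mfun _ _).
  - apply/measurable_EFinP; apply: measurable_funS (mf' n) => //.
  - by apply: aeW => w _; apply/cvg_EFin; [exact: nearW|exact: (fP (n, w))].
  - exact: integrableS (idom n).
  - by apply: aeW => w k _; exact: gdom.
have mart' : martingale F f'.
  split=> [n|n|n m E nm sE].
  - apply: (@measurable_fun_cvg _ (g_sigma_algebraType (sigma F n)) R setT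
      (fun k => g k n) (f' n)) => [k|w _].
      by have [mg _ _] := martspace_mart (g k); exact: mg.
    exact: (fP (n, w)).
  - exact/Lfun1_integrable.
  - have mE := sigma_measurable sE; have := conv m E mE.
    rewrite (_ : (fun k => _) = (fun k => \int[P]_(w in E) (g k n w)%:E)%E).
      by apply: cvg_unique (conv n E mE).
    apply/funext => k; have [_ _ eg] := martspace_mart (g k).
    by rewrite (eg n m E nm sE).
have close n k : ('N[P]_r%:E[EFin \o (f' n \- g k n)%R] <= (rad k)%:E)%E.
  apply/lee_addgt0Pr => e e0.
  have /cvgr0Pnorm_le/(_ e e0)[l _ /(_ (maxn k l) (leq_maxr _ _))/=] := Crad n.
  set j := maxn k l => je.
  have -> : (f' n \- g k n)%R = ((g j - g k) n \+ (f' n \- g j n))%R.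
    apply/funext => w; transitivity (g j n w - g k n w + (f' n w - g j n w)) => //.
    by rewrite addrC subrKA.
  apply: le_trans (eminkowski _ (martspace_mfun _ _) _ p1) _.
    by apply: measurable_funB => //; exact: martspace_mfun.
  apply: leeD.
    by apply: le_trans (Lnorm_martspace _ _) _; rewrite lee_fin gc// leq_maxl.
  apply: Lnorm_le_sup.
    by apply: measurable_funB => //; exact: martspace_mfun.
  move=> w; apply: le_trans (f'g n w j) _.
  by apply: le_trans je; exact: ler_norm.
have mart0 : martingale F (f' - (g 0%N : nat -> T -> R)).
  by rewrite addrC -scaleN1r; apply: martingaleDZ => //; exact: martspace_mart.
have [h [hf _]] := martspace_lift p1 mart0 (close ^~ 0%N).
exists (h + g 0%N) => k; rewrite -lee_fin (martspace_normE (h + g 0%N - g k)).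
apply: ge_ereal_sup => _ [n _ <-].
rewrite (_ : (h + g 0%N - g k : M) n = (f' n \- g k n)%R)//.
apply/funext => w; rewrite martspaceBE martspaceDE hf.
by rewrite -[RHS](subrKA (g 0%N n w)) addrA.
Qed.

End values.

(** * Uniformly integrable and almost surely null martingales *)

Section closed_subspaces.
Context (d : measure_display) (T : measurableType d) (R : realType).
Context (P : probability T R) (F : finite_filtration P).

Lemma measurable_gt (u : T -> R) c : measurable_fun [set: T] u ->
  measurable [set w | c < u w].
Proof.
move=> mu; rewrite [X in measurable X](_ : _ = [set: T] `&` u @^-1` `]c, +oo[).
  exact: mu.
by rewrite setTI; apply/seteqP; split=> w /=; rewrite in_itv/= andbT.
Qed.

Local Notation tail u c :=
  (\int[P]_(w in [set w | (c < `|u w|)%R]) (`|u w|)%:E)%E.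

Lemma measurable_normr (u : T -> R) : measurable_fun [set: T] u ->
  measurable_fun [set: T] (fun w => `|u w|).
Proof. by move=> mu; exact: measurableT_comp. Qed.

Lemma integral_normr_le (u v : T -> R) (S D : set T) :
  measurable_fun [set: T] u -> measurable_fun [set: T] v ->
  measurable S -> measurable D -> S `<=` D ->
  (forall w, S w -> `|u w| <= 2 * `|v w|) ->
  (\int[P]_(w in S) (`|u w|)%:E <= 2%:E * \int[P]_(w in D) (`|v w|)%:E)%E.
Proof.
move=> /measurable_normr mu /measurable_normr mv mS mD SD uv.
have mE (x : T -> R) (B : set T) : measurable_fun [set: T] x ->
    measurable_fun B (fun w => (x w)%:E).
  move=> mx; apply: measurable_funS (@subsetT _ _) _ => //.
  exact/measurable_EFinP.
apply: (@le_trans _ _ (\int[P]_(w in S) (2 * `|v w|)%:E)%E).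
  apply: ge0_le_integral => //.
  - exact: mE.
  - by apply: mE; exact: measurable_funM.
under eq_integral do rewrite EFinM.
rewrite ge0_integralZl//; [|exact: mE].
apply: lee_wpmul2l => //; apply: ge0_subset_integral => //; first exact: mE.
Qed.

(** Where [|u| > 2 * c], the larger of [|v|] and [|z|] is at least half of [|u|],
    so it exceeds [c]. The set [V] tells which of the two is larger. *)
Lemma tail_le (u v z : T -> R) (c : R) : measurable_fun [set: T] u ->
  measurable_fun [set: T] v -> measurable_fun [set: T] z ->
  (forall w, `|u w| <= `|v w| + `|z w|) ->
  (tail u (2 * c) <= 2%:E * tail v c + 2%:E * tail z c)%E.
Proof.
move=> mu mv mz uvz; set S := [set w | 2 * c < `|u w|].
have mS : measurable S by apply: measurable_gt; exact: measurable_normr.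
pose V := [set w | `|v w| < `|z w|].
have mV : measurable V.
  rewrite (_ : V = [set w | 0 < `|z w| - `|v w|]); last first.
    by apply/seteqP; split=> w /=; rewrite subr_gt0.
  by apply: measurable_gt; apply: measurable_funB; exact: measurable_normr.
have mD (x : T -> R) : measurable_fun [set: T] x ->
    measurable [set w | (c < `|x w|)%R].
  by move=> /measurable_normr; exact: measurable_gt.
have mvz (x : T -> R) : measurable_fun [set: T] x ->
    measurable_fun (S `\` V `|` S `&` V) (fun w => `|x w|%:E).
  move=> /measurable_normr mx; apply: measurable_funS (@subsetT _ _) _ => //.
  exact/measurable_EFinP.
have SE : S = S `\` V `|` S `&` V by rewrite setUC setUIDK.
have disj : [disjoint S `\` V & S `&` V] by apply/disj_setPS => w [[_ nV] [_ /nV]].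
have mSD : measurable (S `\` V) by exact: measurableD.
have mSI : measurable (S `&` V) by exact: measurableI.
rewrite [in leLHS]SE (ge0_integral_setU P mSD mSI (mvz u mu) _ disj)//.
apply: leeD; apply: integral_normr_le => //; try exact: mD.
- move=> w [Sw /negP]; rewrite /S/= in Sw; rewrite -leNgt => ?.
  by have := uvz w; rewrite /=; lra.
- by move=> w [_ /negP]; rewrite -leNgt => ?; have := uvz w; rewrite /=; lra.
- by move=> w [Sw]; rewrite /S /V/= in Sw * => ?; have := uvz w; rewrite /=; lra.
- by move=> w [_]; rewrite /V/= => ?; have := uvz w; rewrite /=; lra.
Qed.

Lemma tail_nonincreasing (u : T -> R) (c c' : R) : measurable_fun [set: T] u ->
  c <= c' -> (tail u c' <= tail u c)%E.
Proof.
move=> /measurable_normr mu cc'; apply: ge0_subset_integral => //.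
- exact: measurable_gt.
- exact: measurable_gt.
- by apply: measurable_funS (@subsetT _ _) _ => //; exact/measurable_EFinP.
- by move=> w /=; exact: le_lt_trans.
Qed.

Section uniform_integrability.
Context (p : \bar R) (p1 : (1 <= p)%E).
Local Notation M := (martspace F p1).

Lemma uniformly_integrableP (f : M) : uniformly_integrable F p1 f <->
  forall e : R, 0 < e ->
    exists c : R, forall c' n, c <= c' -> (tail (f n) c' <= e%:E)%E.
Proof.
have mf n : measurable_fun [set: T] (f n).
  by apply: martingale_mfun; have /set_mem[mf _] := martP f; exact: mf.
split=> [fui e e0|H A].
  have : nbhs (0%:E : \bar R) [set x | (x < e%:E)%E].
    apply: open_nbhs_nbhs; split; first exact: open_ereal_lt_ereal.
    by rewrite /= lte_fin.
  move=> /fui; rewrite nbhs_simpl/= => /filter_ex[c /= ce]; exists c => c' n cc'.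
  apply: le_trans (tail_nonincreasing (mf n) cc') _.
  by apply: le_trans (ltW ce); apply: ereal_sup_ubound; exists n.
rewrite {1}/nbhs/= => -[e /= e0 eA].
have [c cP] := H (e / 2) (divr_gt0 e0 (ltr0Sn _ 1)).
exists c; split; first exact: num_real.
move=> c' /ltW cc' /=.
set t := ereal_sup _.
have te : (t <= (e / 2)%:E)%E.
  by apply: ge_ereal_sup => _ [n _ <-]; exact: cP.
have t0 : (0 <= t)%E.
  apply: (le_trans _ (ereal_sup_ubound (ex_intro2 _ _ 0%N I erefl))).
  exact: integral_ge0.
have tfin : t \is a fin_num by rewrite ge0_fin_numE// (le_lt_trans te)// ltry.
rewrite -(fineK tfin); apply: eA.
rewrite /ball_/= sub0r normrN ger0_norm ?fine_ge0//.
rewrite (@le_lt_trans _ _ (e / 2))//; last by rewrite ltr_pdivrMr// ltr_pMr// ltr1n.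
by rewrite -lee_fin fineK.
Qed.

(** Used with [h] bounded, whose tails vanish, and with [h] small in norm,
    whose tails are all small. *)
Lemma uniformly_integrable_split (f : M) :
  (forall e, 0 < e -> exists (g h : M) (c : R), f = g + h /\ forall n,
    (tail (g n) c <= e%:E)%E /\ (tail (h n) c <= e%:E)%E) ->
  uniformly_integrable F p1 f.
Proof.
have mM (g : M) n : measurable_fun [set: T] (g n).
  by apply: martingale_mfun; have /set_mem[mf _] := martP g; exact: mf.
move=> H; apply/uniformly_integrableP => e e0.
have e40 : 0 < e / 4 by rewrite divr_gt0.
have [g [h [c [-> gh]]]] := H _ e40; exists (2 * c) => c' n cc'.
apply: le_trans (tail_nonincreasing (mM (g + h) n) cc') _.
have sum w : `|(g + h) n w| <= `|g n w| + `|h n w| by exact: ler_normD.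
apply: le_trans (tail_le c (mM (g + h) n) (mM g n) (mM h n) sum) _.
have [gc hc] := gh n.
rewrite (_ : e%:E = 2%:E * (e / 4)%:E + 2%:E * (e / 4)%:E)%E; last first.
  by rewrite -!EFinM -EFinD; congr EFin; field.
by apply: leeD; apply: lee_wpmul2l.
Qed.

Lemma uniformly_integrable_bounded (g h : M) B :
  uniformly_integrable F p1 g -> (forall n w, `|h n w| <= B) ->
  uniformly_integrable F p1 (g + h).
Proof.
move=> /uniformly_integrableP gui hB; apply: uniformly_integrable_split => e e0.
have [c cP] := gui e e0.
exists g, h, (Num.max c B); split=> // n; split; first by rewrite cP// le_max lexx.
rewrite (_ : [set w | _] = set0) ?integral_set0 ?lee_fin ?ltW//.
apply/seteqP; split=> // w /=; rewrite gt_max => /andP[_].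
by rewrite ltNge hB.
Qed.

End uniform_integrability.

Section closed.
Context (p1 : (1 <= 1%:E :> \bar R)%E).
Local Notation M := (martspace F p1).

Lemma integral_normr_martspace (f : M) n : (\int[P]_w (`|f n w|)%:E <= `|f|%:E)%E.
Proof. by have := Lnorm_martspace f n; rewrite Lnorm1. Qed.

Lemma uniformly_integrable_closed (f : M) :
  (forall e, 0 < e -> exists2 g : M, uniformly_integrable F p1 g & `|f - g| <= e) ->
  uniformly_integrable F p1 f.
Proof.
move=> H; apply: uniformly_integrable_split => e e0; have [g gui fge] := H e e0.
have /uniformly_integrableP/(_ e e0)[c cP] := gui.
exists g, (f - g), c; split=> [|n]; first by rewrite addrC subrK.
split; first exact: cP.
apply: (@le_trans _ _ `|f - g|%:E); last by rewrite lee_fin.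
apply: le_trans (integral_normr_martspace (f - g) n).
have mfg := measurable_normr (martspace_mfun (f - g) n).
apply: ge0_subset_integral => //; first exact: measurable_gt.
exact/measurable_EFinP.
Qed.

End closed.
End closed_subspaces.

Section maximal_inequality.
Context (d : measure_display) (T : measurableType d) (R : realType).
Context (P : probability T R) (F : finite_filtration P).

Lemma sigma_seqDU n (B : nat -> set T) :
  (forall k, (k <= n)%N -> sigma F k (B k)) -> sigma F n (seqDU B n).
Proof.
move=> sB; rewrite -(sigma_algebra_id (sigma_is_algebra F n)).
apply: (@measurableD _ (g_sigma_algebraType (sigma F n))).
  by apply: sub_sigma_algebra; exact: sB.
have -> : \big[setU/set0]_(k < n) B k = \bigcup_(k < n) B k by rewrite bigcup_mkord.
apply: (@bigcup_measurable _ (g_sigma_algebraType (sigma F n))) => k /= kn.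
apply: sub_sigma_algebra; apply: (@sigma_increasing _ _ _ _ F k) => //.
  exact: ltnW.
by apply: sB; exact: ltnW.
Qed.

(** Doob's weak-type inequality: on the event [D n] that [n] is the first time
    at which [f] exceeds [a], the martingale property moves the integral of
    [f n], at least [a * P (D n)], to any later time [N]. *)
Lemma martingale_maximal f (C a : R) : martingale F f ->
  (forall n, \int[P]_w (`|f n w|)%:E <= C%:E)%E -> 0 < a ->
  (P (\bigcup_n [set w | (a < f n w)%R]) <= (C / a)%:E)%E.
Proof.
move=> mf fC a0; pose B n := [set w | a < f n w].
have mfun n := martingale_mfun n mf.
have sB n : sigma F n (B n).
  rewrite (_ : B n = f n @^-1` `]a, +oo[); first exact: martingale_sigma.
  by apply/seteqP; split=> w /=; rewrite in_itv/= andbT.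
pose D n := seqDU B n.
have sD n : sigma F n (D n) by apply: sigma_seqDU.
have mD n : measurable (D n) by exact: sigma_measurable (sD n).
rewrite -/B seqDU_bigcup_eq measure_semi_bigcup//; last exact: bigcupT_measurable.
have intf n : P.-integrable [set: T] (EFin \o f n).
  by apply/Lfun1_integrable; have [_ lf _] := mf; exact: lf.
have step n N : (n < N)%N -> (a%:E * P (D n) <= \int[P]_(w in D n) (`|f N w|)%:E)%E.
  move=> nN; rewrite -integral_cst//.
  apply: (@le_trans _ _ (\int[P]_(w in D n) (f n w)%:E)%E).
    apply: ge0_le_integral => //.
    - by move=> w _; rewrite /= lee_fin ltW.
    - by apply: measurable_funS (@subsetT _ _) _ => //; exact/measurable_EFinP.
    - by move=> w [/ltW Bw _]; rewrite lee_fin.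
  have [_ _ ef] := mf; rewrite (ef n N (D n) (ltnW nN) (sD n)).
  apply: le_integral => //.
  - exact: integrableS (intf N).
  - by apply: integrableS (integrable_abse (intf N)).
  - by move=> w _; rewrite lee_fin ler_norm.
apply: lime_le.
  by apply: is_cvg_nneseries => n _ _; exact: measure_ge0.
apply: nearW => N /=.
rewrite -(@lee_pmul2l _ a%:E)// ge0_sume_distrr//.
rewrite -EFinM mulrC divfK ?gt_eqF//.
apply: le_trans (fC N).
apply: (@le_trans _ _ (\sum_(0 <= n < N) \int[P]_(w in D n) (`|f N w|)%:E)%E).
  by rewrite !big_nat; apply: lee_sum => n /andP[_ nN]; exact: step.
have mfN : measurable_fun [set: T] (fun w => (`|f N w|)%:E).
  by apply/measurable_EFinP; exact: measurable_normr.
have tD : trivIset [set` index_iota 0 N] D.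
  exact: sub_trivIset (@subsetT _ _) (@trivIset_seqDU _ B).
rewrite -(ge0_integral_bigsetU P mD (iota_uniq _ _) tD)//; last first.
  exact: measurable_funS (@subsetT _ _) mfN.
apply: ge0_subset_integral => //.
exact: bigsetU_measurable.
Qed.

Lemma negligible_small (A : set T) :
  (forall e : R, 0 < e ->
    exists E, [/\ measurable E, A `<=` E & (P E <= e%:E)%E]) ->
  P.-negligible A.
Proof.
move=> H; have /choice[E EP] k : exists E, [/\ measurable E, A `<=` E &
    (P E <= k.+1%:R^-1%:E)%E] by apply: H; rewrite invr_gt0.
have mE k : measurable (E k) by have [] := EP k.
have mI : measurable (\bigcap_k E k) by exact: bigcapT_measurable.
exists (\bigcap_k E k); split=> //; last first.
  by move=> w Aw k _; have [_ + _] := EP k; exact.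
apply/eqP; rewrite eq_le measure_ge0 andbT; apply/lee_addgt0Pr => e e0.
pose k := Num.truncn e^-1.
have ke : k.+1%:R^-1 <= e.
  by rewrite invf_ple ?posrE// ltW// truncnS_gt.
rewrite add0e; apply: (@le_trans _ _ (P (E k))).
  by rewrite le_measure ?inE//; exact: bigcap_inf.
by have [_ _ Ek] := EP k; apply: le_trans Ek _; rewrite lee_fin.
Qed.

Section ae_null_closed.
Context (p1 : (1 <= 1%:E :> \bar R)%E).
Local Notation M := (martspace F p1).

(** If [|f n w| > a] for infinitely many [n], then either [g n w] does not tend
    to zero or [f - g] leaves the interval from [- a / 2] to [a / 2] at some
    time; the maximal inequality makes the latter improbable for [g] near [f]. *)
Lemma ae_null_closed (f : M) :
  (forall e, 0 < e -> exists2 g : M, ae_null F p1 g & `|f - g| <= e) ->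
  ae_null F p1 f.
Proof.
move=> H; pose bad (a : R) := [set w | ~ \forall n \near \oo, `|f n w| <= a].
have bad0 a : 0 < a -> P.-negligible (bad a).
  move=> a0; apply: negligible_small => e e0.
  pose b := a / 2; have b0 : 0 < b by rewrite divr_gt0.
  have eb : 0 < e * b / 2 by rewrite divr_gt0// mulr_gt0.
  have [g [N [mN N0 gN]] fg] := H _ eb.
  pose U (h : M) := \bigcup_n [set w | b < h n w].
  have mU h : measurable (U h).
    by apply: bigcupT_measurable => n; apply: measurable_gt; exact: martspace_mfun.
  have PU (h : M) : `|h| <= e * b / 2 -> (P (U h) <= (e / 2)%:E)%E.
    move=> he; rewrite (_ : e / 2 = (e * b / 2) / b); last first.
      by field; rewrite gt_eqF.
    apply: martingale_maximal => //; first exact: martspace_mart.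
    move=> n; apply: le_trans (integral_normr_martspace h n) _.
    by rewrite lee_fin.
  exists (N `|` (U (f - g) `|` U (g - f))); split.
  - by apply: measurableU => //; exact: measurableU.
  - move=> w badw; apply: contrapT => /not_orP[nNw /not_orP[nU1 nU2]].
    apply: badw; have gw : g n w @[n --> \oo] --> 0.
      by apply: contrapT => ngw; apply: nNw; exact: gN.
    have /cvgr0Pnorm_le/(_ b b0) := gw; apply: filterS => n gnw.
    have u1 : (f - g) n w <= b.
      by rewrite leNgt; apply/negP => lt; apply: nU1; exists n.
    have u2 : (g - f) n w <= b.
      by rewrite leNgt; apply/negP => lt; apply: nU2; exists n.
    move: gnw u1 u2; rewrite !martspaceBE !ler_norml => /andP[g1 g2] u1 u2.
    rewrite /b in g1 g2 u1 u2 *; apply/andP; split; lra.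
  - apply: le_trans (measureU2 _ _ _) _ => //; first exact: measurableU.
    rewrite [X in (X + _)%E](_ : _ = 0%E) ?add0e; last exact: N0.
    apply: le_trans (measureU2 _ _ _) _ => //.
    rewrite (_ : e%:E = (e / 2)%:E + (e / 2)%:E)%E; last first.
      by rewrite -EFinD; congr EFin; field.
    by apply: leeD; apply: PU; rewrite // distrC.
rewrite /ae_null/=.
suff : P.-negligible (\bigcup_k bad k.+1%:R^-1).
  apply: negligibleS => w /= nw; apply: contrapT => nbad; apply: nw.
  apply/cvgr0Pnorm_le => e e0.
  pose k := Num.truncn e^-1.
  have ke : k.+1%:R^-1 <= e by rewrite invf_ple ?posrE// ltW// truncnS_gt.
  have : \forall n \near \oo, `|f n w| <= k.+1%:R^-1.
    by apply: contrapT => nb; apply: nbad; exists k.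
  by apply: filterS => n fn; exact: le_trans fn ke.
by apply: negligible_bigcup => k; apply: bad0; rewrite invr_gt0.
Qed.

Lemma ae_nullD (g h : M) : ae_null F p1 g -> ae_null F p1 h -> ae_null F p1 (g + h).
Proof.
rewrite /ae_null/= => gn hn; apply: filterS2 gn hn => w gw hw.
by rewrite -[0]addr0; exact: cvgD.
Qed.

End ae_null_closed.
End maximal_inequality.

(** * Baire category and oscillation along branches *)

Section baire.
Context (R : realType) (V : normedModType R) (Y : set V).

(** Completeness in the form in which a decreasing sequence of balls uses it. *)
Definition radius_complete := forall (g : nat -> V) (rad : nat -> R),
  (forall k, Y (g k)) -> rad @ \oo --> 0 ->
  (forall k l, (k <= l)%N -> `|g l - g k| <= rad k) ->
  exists2 f, Y f & forall k, `|f - g k| <= rad k.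

(** Baire's theorem for a complete subset [Y] of a normed space: the radii of
    the nested balls at least halve, and each closed ball lies in the next
    open set. *)
Lemma baire_subset (O : nat -> set V) : radius_complete ->
  (forall i, open (O i)) ->
  (forall i g e, Y g -> 0 < e -> exists h, [/\ Y h, `|h - g| < e & O i h]) ->
  forall g e, Y g -> 0 < e -> exists f, [/\ Y f, `|f - g| < e & forall i, O i f].
Proof.
move=> cY oO dO g e Yg e0.
pose good (x : V * R) := Y x.1 /\ 0 < x.2.
have /choice[next nextP] (ix : nat * (V * R)) : exists y : V * R, good ix.2 ->
    [/\ good y, `|y.1 - ix.2.1| + y.2 <= ix.2.2, y.2 <= ix.2.2 / 2 &
        forall z, `|z - y.1| <= y.2 -> O ix.1 z].
  case: ix => i [h a] /=; have [[/= Yh a0]|] := pselect (good (h, a)); last first.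
    by move=> ng; exists (h, a) => /ng.
  have a20 : 0 < a / 2 by rewrite divr_gt0.
  have [h' [Yh' hh' Oh']] := dO i h (a / 2) Yh a20.
  have /nbhs_ballP[b /= b0 bO] : nbhs h' (O i) by apply: open_nbhs_nbhs.
  (* Halving [b] puts the closed ball inside the open ball of radius [b]. *)
  exists (h', Num.min (a / 2) (b / 2)) => _ /=; split.
  - by split=> //=; rewrite lt_min a20 divr_gt0.
  - have : Num.min (a / 2) (b / 2) <= a / 2 by rewrite ge_min lexx.
    lra.
  - by rewrite ge_min lexx.
  - move=> z zh; apply: bO; rewrite -ball_normE /ball_/= distrC.
    apply: le_lt_trans zh _; rewrite gt_min; apply/orP; right.
    by rewrite ltr_pdivrMr// ltr_pMr// ltr1n.
pose s := fix s j := if j is i.+1 then next (i, s i) else (g, e / 2).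
have gs j : good (s j).
  elim: j => [|j IH]; first by split=> //=; rewrite divr_gt0.
  by have [] := nextP (j, s j) IH.
have sP j := nextP (j, s j) (gs j).
have near k l : (k <= l)%N -> `|(s l).1 - (s k).1| + (s l).2 <= (s k).2.
  move=> /subnKC <-; elim: (l - k)%N => [|i IH].
    by rewrite addn0 subrr normr0 add0r.
  rewrite addnS; have [_ /= le _ _] := sP (k + i)%N.
  have := ler_normD ((next (k + i, s (k + i))%N).1 - (s (k + i)%N).1)
                    ((s (k + i)%N).1 - (s k).1).
  rewrite subrKA => tri; lra.
have rad0 : (fun k => (s k).2) @ \oo --> 0.
  have half k : (s k).2 <= (e / 2) * 2^-1 ^+ k.
    elim: k => [|k IH]; first by rewrite expr0 mulr1.
    have [_ _ /= le _] := sP k; apply: le_trans le _.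
    by rewrite exprSr mulrA ler_pM2r// invr_gt0.
  apply: (@squeeze_cvgr _ _ _ _ (fun=> 0) (fun k => e / 2 * 2^-1 ^+ k)).
  - by apply: nearW => k; rewrite half andbT; apply: ltW; have [] := gs k.
  - exact: cvg_cst.
  - rewrite -[X in _ --> X](mulr0 (e / 2)); apply: cvgM; first exact: cvg_cst.
    by apply: cvg_expr; rewrite gtr0_norm// invf_lt1// ltr1n.
have [f Yf fs] := cY (fun k => (s k).1) (fun k => (s k).2) (fun k => (gs k).1)
  rad0 (fun k l kl => le_trans (ler_wpDr (ltW (gs l).2) (lexx _)) (near k l kl)).
exists f; split=> // [|i].
  by apply: le_lt_trans (fs 0%N) _ => /=; rewrite ltr_pdivrMr// ltr_pMr// ltr1n.
by have [_ _ _] := sP i; apply; exact: (fs i.+1).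
Qed.

End baire.

Section limsup.
Context (R : realType).
Implicit Type u : nat -> R.

Lemma limn_esup_pinfty u : (limn_esup (fun n => (u n)%:E) = +oo)%E <->
  forall N, exists2 n, (N <= n)%N & N%:R < u n.
Proof.
rewrite limn_esup_lim (cvg_lim _ (@cvg_esups_inf _ _))//; split=> [uoo N|H].
  have : (N%:R%:E < esups (fun n => (u n)%:E) N)%E.
    apply: (@lt_le_trans _ _ +oo%E); first exact: ltry.
    by rewrite -uoo; apply: ereal_inf_lbound; exists N.
  by move=> /ereal_sup_gt[_ [n /= Nn <-]]; rewrite lte_fin => ?; exists n.
apply: eq_infty => t; apply: le_ereal_inf_tmp => _ [k _ <-].
have [n kn tn] := H (maxn k (Num.truncn t).+1).
apply: (@le_trans _ _ (u n)%:E); last first.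
  apply: ereal_sup_ubound; exists n => //=.
  exact: leq_trans (leq_maxl _ _) kn.
rewrite lee_fin (le_trans _ (ltW tn))// (le_trans (ltW (truncnS_gt t)))//.
by rewrite ler_nat leq_maxr.
Qed.

Lemma limn_einf_ninfty u : (limn_einf (fun n => (u n)%:E) = -oo)%E <->
  forall N, exists2 n, (N <= n)%N & N%:R < - u n.
Proof.
rewrite -(limn_esup_pinfty (fun n => - u n)) /limn_einf.
rewrite (_ : (fun n => (- u n)%:E) = \- (fun n => (u n)%:E))%E//.
by split=> [/eqP|->//]; rewrite eqe_oppLR => /eqP.
Qed.

End limsup.

Section oscillation.
Context (d : measure_display) (T : measurableType d) (R : realType).
Context (P : probability T R) (F : finite_filtration P).
Local Notation K := (set_type (branches F)).
Local Notation atom_sequences :=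
  (prod_topology (fun n => discrete_topology (set_type (atom F n)))).

Definition oscillates_beyond (f : nat -> T -> R) (x : K) (N : nat) :=
  (exists2 n, (N <= n)%N & N%:R < value_at f x n) /\
  (exists2 n, (N <= n)%N & N%:R < - value_at f x n).

Lemma oscillatesP (f : nat -> T -> R) (x : K) :
  oscillates f x <-> forall N, oscillates_beyond f x N.
Proof.
rewrite /oscillates (limn_esup_pinfty (value_at f x))
  (limn_einf_ninfty (value_at f x)); split=> [[h1 h2] N|H].
  by split; [exact: h1|exact: h2].
by split=> N; have [] := H N.
Qed.

Lemma branches_atom (x : K) n : atom F n (set_val (set_val x n)).
Proof. by have /set_mem := valP (set_val x n). Qed.

Lemma branches_sub (x : K) n m : (n <= m)%N ->
  set_val (set_val x m) `<=` set_val (set_val x n).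
Proof. by have /set_mem := valP x; apply. Qed.

Lemma branchesE (x y : K) n k : (k <= n)%N ->
  set_val x n = set_val y n -> set_val x k = set_val y k.
Proof.
move=> kn xy; have [w xw] := atom_nonempty (branches_atom x n).
apply: val_inj.
apply: (atom_unique (branches_atom x k) (branches_atom y k) (w := w)).
  exact: branches_sub kn _ xw.
by apply: branches_sub kn _ _; rewrite -xy.
Qed.

Lemma branch_branches A : branch F A ->
  exists x : K, forall n, set_val (set_val x n) = A n.
Proof.
move=> [aA sA].
pose x : atom_sequences := fun n => exist _ (A n) (mem_set (aA n)).
have bx : branches F x by move=> n m nm; exact: sA.
by exists (exist _ x (mem_set bx)).
Qed.

(** Cylinders form a neighbourhood basis; fixing one coordinate of a branch
    fixes all earlier ones. *)
Lemma nbhs_branches (x : K) (B : set K) : nbhs x B ->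
  exists n, forall y : K, set_val y n = set_val x n -> B y.
Proof.
case=> _ /= [[C oC <-]] /= Cx CB.
pose cyl n := [set z : atom_sequences |
  forall k, (k <= n)%N -> z k = set_val x k].
(* The cylinders around [x] generate a filter that converges to [x] in each
   coordinate, so it contains every neighbourhood of [x]. *)
pose G := filter_from [set: nat] cyl.
have FG : Filter G.
  apply: filter_from_filter; first by exists 0%N.
  move=> i j _ _; exists (maxn i j) => // z zc.
  by split=> k kn; apply: zc; rewrite (leq_trans kn)// ?leq_maxl ?leq_maxr.
have Gx : G --> (set_val x : prod_topology _).
  apply/cvg_sup => i A [_ [[D oD <-]]] /= Dx DA.
  exists i => // z zc; apply: DA => /=; rewrite /= in Dx.
  by rewrite zc.
have [n _ nC] : G C by apply: Gx; apply: open_nbhs_nbhs.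
exists n => y yx; apply: CB => /=; apply: nC => k kn.
exact: branchesE kn yx.
Qed.

Lemma open_cylinder (x : K) n : open [set y : K | set_val y n = set_val x n].
Proof.
exists (proj n @^-1` [set set_val x n]) => //.
apply: open_comp; last exact: discrete_open.
by move=> z _; exact: proj_continuous.
Qed.

End oscillation.

(** * Genericity *)

Section generic.
Context (d : measure_display) (T : measurableType d) (R : realType).
Context (P : probability T R) (F : finite_filtration P).
Context (r : R) (p1 : (1 <= r%:E)%E).
Local Notation M := (martspace F p1).
Local Notation K := (set_type (branches F)).

Lemma martspace_value_continuous n w : continuous (fun f : M => f n w : R).
Proof.
move=> f; have [C C0 CP] := martspace_value_bound F p1 n.
have FF : Filter (nbhs (f : M)) := nbhs_filter (f : M).
apply/(@cvgrPdist_lt _ _ _ _ FF) => e e0.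
(* [C] may be zero, hence the divisor [C + 1]. *)
have C1 : 0 < C + 1 by rewrite ltr_wpDl.
apply: (@filterS _ (nbhs (f : M)) FF (ball (f : M) (e / (C + 1)))); last first.
  by apply: nbhsx_ballx; rewrite divr_gt0.
move=> g; rewrite -ball_normE /ball_/= => fg; rewrite -martspaceBE.
apply: le_lt_trans (CP (f - g) w) _.
apply: (@le_lt_trans _ _ ((C + 1) * `|f - g|)).
  by rewrite ler_wpM2r// lerDl.
by rewrite mulrC -ltr_pdivlMr.
Qed.

Lemma open_value_gt n w (s c : R) : open [set f : M | c < s * f n w].
Proof.
have /continuousP : continuous (fun f : M => s * f n w).
  move=> f; have FF : Filter (nbhs (f : M)) := nbhs_filter (f : M).
  by apply: (cvgM (FF := FF)); [exact: cvg_cst|exact: martspace_value_continuous].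
by move=> /(_ _ (@open_gt R c)).
Qed.

(** The sign [s] is [1] or [-1], for large positive or large negative values. *)
Definition large (s : R) m (D : set T) N : set M :=
  [set f | exists n w, [/\ (m <= n)%N, (N <= n)%N, D w & N%:R < s * f n w]].

Lemma open_large s m D N : open (large s m D N).
Proof.
rewrite (_ : large s m D N = \bigcup_(nw in [set nw : nat * T |
   [/\ (m <= nw.1)%N, (N <= nw.1)%N & D nw.2]])
   [set f : M | N%:R < s * f nw.1 nw.2]).
  by apply: bigcup_open => -[n w] _; exact: open_value_gt.
apply/seteqP; split=> [f [n [w [mn Nn Dw fw]]]|f [[n w] [/= mn Nn Dw] fw]].
  by exists (n, w).
by exists n, w.
Qed.

Context (Y : set M) (Ybump : bump_stable F p1 Y).
Context (Yclosed : forall f,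
  (forall e, 0 < e -> exists2 g, Y g & `|f - g| <= e) -> Y f).

Let r1 : 1 <= r. Proof. by rewrite -lee_fin. Qed.
Let r0 : 0 < r. Proof. exact: lt_le_trans ltr01 r1. Qed.

(** As [N + 1 + |g k|] is bounded in [L^r] uniformly in [k], it has a small [L^r]
    norm on some atom [E] inside [D] of a late level [k]. A bump of that height
    on [E] is small and overrides the value of [g] there. *)
Lemma large_dense s m D N g e : `|s| = 1 -> atom F m D -> Y g -> 0 < e ->
  exists h, [/\ Y h, `|h - g| < e & large s m D N h].
Proof.
move=> s1 aD Yg e0.
pose c k w : R := N.+1%:R + `|g k w|.
have c0 k w : 0 < c k w by rewrite ltr_wpDr.
have mc k : measurable_fun [set: T] (c k).
  apply: measurable_funD => //; apply: measurable_normr; exact: martspace_mfun.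
have cN k : ('N[P]_r%:E[EFin \o c k] <= (N.+1%:R + `|g|)%:E)%E.
  have mg := measurable_normr (martspace_mfun g k).
  apply: le_trans (eminkowski P (f := cst N.+1%:R) (measurable_cst _) mg p1) _.
  rewrite EFinD; apply: leeD.
    by apply: (Lnorm_le_sup P p1) => // w; rewrite /= ger0_norm.
  by have := Lnorm_martspace g k; rewrite -(Lnorm_abse P (EFin \o g k)).
pose u k w : R := c k w `^ r.
have [//|//|||k [E [mNk aE ED]]] := @atom_small_integral _ _ _ P F u
    ((N.+1%:R + `|g|) `^ r) (e `^ r) m D (maxn m N) _ _ _ _ aD.
- by move=> k; apply: (measurableT_comp (measurable_powR _)).
- by move=> k w; exact: powR_ge0.
- move=> k; apply: (le_trans _ (integral_powR_le p1 (cN k))).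
  by under [leRHS]eq_integral do rewrite gtr0_norm//.
- by rewrite powR_gt0.
move: mNk; rewrite geq_max => /andP[mk Nk] uE.
have [w0 Ew0] := atom_nonempty aE.
have cE w : E w -> c k w = c k w0.
  by move=> Ew; rewrite /c (martingale_atom (martspace_mart g) aE Ew Ew0).
have small : c k w0 * fine (P E) `^ r^-1 < e.
  rewrite ltNge; apply/negP => le.
  have := ge0_ler_powR (ltW r0); rewrite /= => /(_ e (c k w0 * fine (P E) `^ r^-1)).
  rewrite !nnegrE => /(_ (ltW e0) _ le).
  rewrite mulr_ge0 ?powR_ge0 ?(ltW (c0 _ _))// => /(_ isT).
  apply/negP; rewrite -ltNge.
  rewrite powRM ?powR_ge0 ?(ltW (c0 _ _))// powRK ?gt_eqF ?fine_ge0//.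
  rewrite -lte_fin; apply: le_lt_trans uE.
  have := integral_powR_atom P (u := c k) r (atom_measurable aE) cE.
  rewrite (gtr0_norm (c0 _ _)) => <-.
  rewrite le_eqVlt; apply/orP; left; apply/eqP; apply: eq_integral => w _.
  by rewrite gtr0_norm.
have [h [Yh hn hE]] := Ybump (s * c k w0) aE.
exists (g + h); split; first exact: Yh.
  rewrite addrC addKr; apply: le_lt_trans hn _.
  by rewrite normrM s1 mul1r gtr0_norm.
exists k, w0; split=> //; first exact: ED.
(* The sign squares to one, so [s] times the bump is its height [c k w0]. *)
rewrite martspaceDE hE// mulrDr mulrA.
have -> : s * s = 1 by rewrite -expr2 -real_normK ?num_real// s1 expr1n.
rewrite mul1r /c -natr1.
have : - (s * g k w0) <= `|g k w0|.
  by apply: le_trans (ler_norm _) _; rewrite normrN normrM s1 mul1r.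
lra.
Qed.

(** Start from the [n]-th atom of [x] and pass to a subatom where some [f i]
    exceeds [j], then to one where some [- f i] exceeds [j], for [j = 0], [1],
    and so on; the branch through these atoms is [y]. *)
Lemma large_oscillates (f : M) (x : K) n :
  (forall m D N, atom F m D -> large 1 m D N f /\ large (-1) m D N f) ->
  exists2 y : K, set_val y n = set_val x n & oscillates f y.
Proof.
move=> fL; have mf := martspace_mart f.
pose good (k : nat * set T) := atom F k.1 k.2.
have /choice[next nextP] (jk : nat * (nat * set T)) : exists k' : nat * set T,
    good jk.2 -> [/\ good k', (jk.1 < k'.1)%N, k'.2 `<=` jk.2.2 &
      (exists2 i, (jk.1 <= i <= k'.1)%N & forall w, k'.2 w -> jk.1%:R < f i w) /\
      (exists2 i, (jk.1 <= i <= k'.1)%N & forall w, k'.2 w -> jk.1%:R < - f i w)].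
  case: jk => j [k D] /=; have [aD|] := pselect (good (k, D)); last first.
    by move=> ng; exists (k, D) => /ng.
  (* The threshold [j.+1] also makes the new level exceed [j], which places the
     [j]-th chosen atom at a level of at least [j]. *)
  have [[n1 [w1 [kn1 jn1 Dw1 f1]]] _] := fL k D j.+1 aD.
  have [a1 E1] := atom_ofP F n1 w1.
  have [_ [n2 [w2 [n12 jn2 E1w2 f2]]]] := fL n1 (atom_of F n1 w1) j.+1 a1.
  have [a2 E2] := atom_ofP F n2 w2.
  have s2 := atom_sub n12 a1 a2 E1w2 E2.
  exists (n2, atom_of F n2 w2) => _ /=; split=> //.
    exact: subset_trans s2 (atom_sub kn1 aD a1 Dw1 E1).
  have jlt : j%:R < j.+1%:R :> R by rewrite ltr_nat.
  split.
  - exists n1; first by rewrite (ltnW jn1).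
    move=> w /s2 E1w; rewrite (martingale_atom mf a1 E1w E1).
    by rewrite mul1r in f1; exact: lt_trans jlt f1.
  - exists n2; first by rewrite (ltnW jn2) leqnn.
    move=> w E2w; rewrite (martingale_atom mf a2 E2w E2).
    by rewrite mulN1r in f2; exact: lt_trans jlt f2.
pose s := fix s j := if j is i.+1 then next (i, s i)
  else (n, set_val (set_val x n)) : nat * set T.
have gs j : good (s j).
  elim: j => [|j IH]; first exact: branches_atom.
  by have [] := nextP (j, s j) IH.
have sP j := nextP (j, s j) (gs j).
have js j : (j <= (s j).1)%N by case: j => // j; have [] := sP j.
have sub j : (s j.+1).2 `<=` (s j).2 by have [] := sP j.
have [A bA As] := nested_branch js gs sub.
have [y yA] := branch_branches bA; exists y.
  by apply: val_inj; exact: etrans (yA n) (As 0%N).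
apply/oscillatesP => N.
have [_ _ _ [[i /andP[Ni iN] fi] [i' /andP[Ni' iN'] fi']]] := sP N.
have [w sw] := atom_nonempty (gs N.+1).
have val j : (j <= (s N.+1).1)%N -> value_at f y j = f j w.
  move=> jN; have yw : set_val (set_val y j) w.
    by rewrite yA; apply: (bA.2 _ _ jN); rewrite As.
  exact: value_on_atom mf (branches_atom y j) yw.
by split; [exists i|exists i'] => //; rewrite val//; [exact: fi|exact: fi'].
Qed.

(** Makes the requirement of large values on every atom a countable family of
    open conditions. *)
Lemma atoms_enumeration : exists q : nat -> nat * set T,
  (forall j, atom F (q j).1 (q j).2) /\
  (forall m D, atom F m D -> exists j, q j = (m, D)).
Proof.
pose A := \bigcup_m [set (m, D) | D in atom F m].
have /countable_injP[c ci] : countable A.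
  apply: bigcup_countable => // m _; apply: finite_set_countable.
  exact: finite_image (atom_finite F m).
have A0 : A (0%N, atom_of F 0 point).
  have [a0 _] := atom_ofP F 0 point.
  by exists 0%N => //; exists (atom_of F 0 point).
have /choice[q qP] j : exists q, A q /\ forall a, A a -> c a = j -> q = a.
  have [[a [Aa ca]]|none] := pselect (exists a, A a /\ c a = j).
    exists a; split=> // b Ab cb; apply: ci; rewrite ?inE//.
    by rewrite ca cb.
  by exists (0%N, atom_of F 0 point); split=> // a Aa ca; case: none; exists a.
exists q; split=> [j|m D aD].
  by have [[m _ [D aD <-]] _] := qP j.
exists (c (m, D)); have [_] := qP (c (m, D)); apply=> //.
by exists m => //; exists D.
Qed.

Lemma radius_complete_closed : radius_complete Y.
Proof.
move=> g rad Yg rad0 gc; have [f fg] := martspace_complete rad0 gc.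
exists f => //; apply: Yclosed => e e0.
have /cvgr0Pnorm_le/(_ e e0)[k _ /(_ k (leqnn k))/= ke] := rad0.
exists (g k) => //; apply: le_trans (fg k) _.
exact: le_trans (ler_norm _) ke.
Qed.

(** For [y] near [x] the [n]-th atoms agree, so the value at [y] is the value of
    the martingale at a fixed point [w], which depends continuously on it. *)
Lemma open_oscillates_beyond N :
  open [set fx : set_type Y * K | oscillates_beyond (set_val fx.1) fx.2 N].
Proof.
have open_gt (s : R) : open [set fx : set_type Y * K |
    exists2 n, (N <= n)%N & N%:R < s * value_at (set_val fx.1) fx.2 n].
  rewrite openE => -[f x] /= [n Nn fx].
  have [w xw] := atom_nonempty (branches_atom x n).
  have val (g : set_type Y) (y : K) : set_val y n = set_val x n ->
      value_at (set_val g) y n = (set_val g : M) n w.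
    move=> yx; rewrite /value_at yx.
    by apply: value_on_atom (branches_atom x n) xw; exact: martspace_mart.
  exists ([set g : set_type Y | N%:R < s * (set_val g : M) n w],
          [set y : K | set_val y n = set_val x n]).
    split=> /=; apply: open_nbhs_nbhs; split=> //=.
    - by exists [set f : M | N%:R < s * f n w] => //; exact: open_value_gt.
    - by rewrite -(val f x).
    - exact: open_cylinder.
  by move=> [g y] [/= gw yx]; exists n => //; rewrite (val g y).
rewrite (_ : mkset _ = [set fx : set_type Y * K |
    exists2 n, (N <= n)%N & N%:R < 1 * value_at (set_val fx.1) fx.2 n] `&`
  [set fx : set_type Y * K |
    exists2 n, (N <= n)%N & N%:R < -1 * value_at (set_val fx.1) fx.2 n]).
  exact: openI.
apply/seteqP; split=> -[f x] /= [[n Nn fn] [m Nm fm]].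
  by split; [exists n; rewrite ?mul1r|exists m; rewrite ?mulN1r].
rewrite mul1r in fn; rewrite mulN1r in fm.
by split; [exists n|exists m].
Qed.

(** Every [f] in the generic set [G] oscillates along a dense set of branches;
    this gives the second claim, and with the density of [G] also that of the
    set of oscillating pairs. *)
Lemma generic_oscillation :
  dense_Gdelta [set fx : set_type Y * K | oscillates (set_val fx.1) fx.2] /\
  exists2 G : set (set_type Y), dense_Gdelta G &
    forall f : set_type Y, G f ->
      exists2 H : set K, dense_Gdelta H &
        forall x : K, H x -> oscillates (set_val f) x.
Proof.
have [q [aq qP]] := atoms_enumeration.
pose O k : set M := if unpickle k is Some (j, N, b)
  then large (if b then 1 else -1) (q j).1 (q j).2 N else setT.
have oO k : open (O k).
  by rewrite /O; case: unpickle => [[[j N] b]|]; [exact: open_large|exact: openT].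
have dO k g e : Y g -> 0 < e -> exists h, [/\ Y h, `|h - g| < e & O k h].
  move=> Yg e0; rewrite /O; case: unpickle => [[[j N] b]|].
    by apply: large_dense => //; case: b; rewrite ?normrN normr1.
  by exists g; rewrite subrr normr0.
pose G := [set f : set_type Y | forall k, O k (set_val f)].
have G_large f : G f -> forall m D N, atom F m D ->
    large 1 m D N (set_val f) /\ large (-1) m D N (set_val f).
  move=> Gf m D N /qP[j qj].
  have := Gf (pickle (j, N, true)); have := Gf (pickle (j, N, false)).
  by rewrite /O !pickleK qj.
have dG : dense G.
  move=> U [g Ug] [B oB BU].
  have Bg : B (set_val g) by rewrite -BU in Ug.
  have /nbhs_ballP[e /= e0 eB] : nbhs (set_val g) B by exact: open_nbhs_nbhs.
  have [f [Yf fg fO]] := baire_subset radius_complete_closed oO dO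
    (set_mem (valP g)) e0.
  exists (exist _ f (mem_set Yf)); split; last exact: fO.
  by rewrite -BU /=; apply: eB; rewrite -ball_normE /ball_/= distrC.
have GG : Gdelta G.
  exists (fun k => set_val @^-1` O k) => [k|]; first by exists (O k).
  by apply/seteqP; split=> f Of k; [move=> _; exact: Of|exact: (Of k I)].
have sec f : G f -> dense [set x : K | oscillates (set_val f) x].
  move=> Gf U [x Ux] oU.
  have [n nU] := nbhs_branches (open_nbhs_nbhs (conj oU Ux)).
  have [y yx fy] := large_oscillates x n (G_large f Gf).
  by exists y; split=> //; exact: nU.
split; [split|].
- move=> W [[g x] Wgx] oW.
  have [[A B] /= [nA nB] ABW] : nbhs (g, x) W by exact: open_nbhs_nbhs.
  have [f [Af Gf]] := dG A° (ex_intro _ g nA) (open_interior A).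
  have [y [By fy]] := sec f Gf B° (ex_intro _ x nB) (open_interior B).
  by exists (f, y); split=> //; apply: ABW; split; exact: interior_subset.
- exists (fun N => [set fx : set_type Y * K |
    oscillates_beyond (set_val fx.1) fx.2 N]).
    exact: open_oscillates_beyond.
  apply/seteqP; split=> fx /=.
    by move=> /oscillatesP H N _; exact: H.
  by move=> H; apply/oscillatesP => N; exact: (H N I).
exists G => // f Gf; exists [set x : K | oscillates (set_val f) x] => //; split.
  exact: sec.
exists (fun N => [set x : K | oscillates_beyond (set_val f) x N]).
  move=> N; rewrite openE => x fx.
  have := @open_oscillates_beyond N.
  rewrite openE => /(_ (f, x) fx)[[A B] /= [nA nB] AB].
  apply: filterS nB => y By; apply: (AB (f, y)); split=> //=.
  exact: nbhs_singleton nA.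
apply/seteqP; split=> x /=.
  by move=> /oscillatesP H N _; exact: H.
by move=> H; apply/oscillatesP => N; exact: (H N I).
Qed.

End generic.

Theorem theorem4p1 (d : measure_display) (T : measurableType d) (R : realType)
    (P : probability T R) (F : finite_filtration P)
    (p : \bar R) (p1 : (1 <= p)%E) (Y : set (martspace F p1)) :
  [\/ (p = 1%E /\ Y = setT),
      (p = 1%E /\ Y = uniformly_integrable F p1),
      (p = 1%E /\ Y = ae_null F p1)
    | ((1 < p < +oo)%E /\ Y = setT)] ->
  dense_Gdelta
    [set fx : set_type Y * set_type (branches F) |
       oscillates (set_val fx.1) fx.2] /\
  exists2 G : set (set_type Y), dense_Gdelta G &
    forall f : set_type Y, G f ->
      exists2 H : set (set_type (branches F)), dense_Gdelta H &
        forall x : set_type (branches F), H x -> oscillates (set_val f) x.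
Proof.
have bumpT (r : R) (r1 : (1 <= r%:E)%E) : bump_stable F r1 setT.
  by move=> n E c aE; have [h [_ hn hE]] := bounded_bump r1 c aE; exists h.
case=> [[p_1 ->]|[p_1 YE]|[p_1 YE]|[/andP[_ pfin] ->]].
- by move: p1 Y; rewrite p_1 => p1 _; apply: generic_oscillation.
- subst p; rewrite YE; apply: generic_oscillation; last first.
    exact: uniformly_integrable_closed.
  move=> n E c aE; have [h [[B hB] hn hE]] := bounded_bump p1 c aE.
  by exists h; split=> // g gui; exact: uniformly_integrable_bounded gui hB.
- subst p; rewrite YE; apply: generic_oscillation; last exact: ae_null_closed.
  move=> n E c aE; have [h [hnull hn hE]] := null_bump p1 c aE.
  by exists h; split=> // g gn; exact: ae_nullD.
- by case: p p1 Y pfin => [r||] // p1 Y _; apply: generic_oscillation.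
Qed.
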